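(* Let $p\ge 5$ be a prime and $\mathbf{F}$ a field of characteristic $p$. Choose a basis $\{X_1,X_2,X_3,X_4\}$ of $V_4^*$ with $\Delta(X_i)=X_{i-1}$ for $i>1$ and $\Delta(X_1)=0$, and let $C:=\mathbf{F}[V_4]_{\mathbf{Z}/p}$ be the ring of coinvariants, with $C^d$ its homogeneous component of degree $d$. As $\mathbf{F}\mathbf{Z}/p$-modules: (i) $C^0\cong C^{2p-3}\cong V_1$ and $C^1\cong V_3$. (ii) For $d=p,\ldots, 2p-4$, $$C^d=x_3^{d-(p-1)}x_4^{p-1}\,\mathbf{F}\mathbf{Z}/p\ \oplus\ x_2x_3^{d-p}x_4^{p-1}\,\mathbf{F}\mathbf{Z}/p\ \cong\ V_{2p-2-d}\oplus V_{2p-3-d}$$ with $(C^d)^{\mathbf{Z}/p}=\mathrm{Span}\{x_3^{p-2}x_4^{d-(p-2)},\ x_2x_3^{p-4}x_4^{d-(p-3)}\}$. (iii) For $d=p-1,\ p-2$, $$C^d=x_4^d\,\mathbf{F}\mathbf{Z}/p\ \oplus\ x_2x_4^{d-1}\,\mathbf{F}\mathbf{Z}/p\ \cong\ V_{p-1}\oplus V_{p-3}$$ with $(C^d)^{\mathbf{Z}/p}=\mathrm{Span}\{x_3^{p-2}x_4^{d-(p-2)},\ x_2x_3^{p-4}x_4^{d-(p-3)}\}$. (iv) For $d=2,\ldots,p-3$, $$C^d=x_4^d\,\mathbf{F}\mathbf{Z}/p\ \oplus\ \left(x_3^2x_4^{d-2}-\tfrac{d+2}{2}\, x_2x_4^{d-1}\right)\mathbf{F}\mathbf{Z}/p\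 \cong\ V_{d+2}\oplus V_{d-1}$$ with $(C^d)^{\mathbf{Z}/p}=\mathrm{Span}\{x_3^d-d\, x_2x_3^{d-2}x_4,\ x_2 x_3^{d-1}\}$.
   Context: For $n\le p$, $V_n$ is the $n$-dimensional indecomposable representation over $\mathbf{F}$ of the cyclic group $\mathbf{Z}/p=\langle\sigma\rangle$ on which $\sigma$ acts by a single Jordan block with eigenvalue $1$. The action on $V_n^*$ extends to algebra automorphisms of $\mathbf{F}[V_n]=S(V_n^* )$; $\Delta:=\sigma-1$. The Hilbert ideal is the ideal of $\mathbf{F}[V_n]$ generated by all homogeneous invariants of positive degree, and the ring of coinvariants $\mathbf{F}[V_n]_{\mathbf{Z}/p}$ is the quotient of $\mathbf{F}[V_n]$ by the Hilbert ideal, with its induced grading and $\mathbf{Z}/p$-action. Lower case letters $x_i$ denote images of $X_i$ in the coinvariants. For a module element $f$, $f\,\mathbf{F}\mathbf{Z}/p$ denotes the cyclic submodule it generates; $(\,\cdot\,)^{\mathbf{Z}/p}$ denotes fixed points. *)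

(* Defs.v *)
From HB Require Import structures.
From mathcomp Require Import all_boot all_order all_fingroup all_algebra.
From mathcomp Require Import mxrepresentation generic_quotient ring_quotient.
From mathcomp Require Import boolp.
From mathcomp Require Import mpoly.

Set Implicit Arguments.
Unset Strict Implicit.
Unset Printing Implicit Defensive.

Import GRing.Theory.
Local Open Scope ring_scope.
Local Open Scope quotient_scope.

(* An F G-module is given by an F-vector space M and an action               *)
(* act : gT -> M -> M of the group; its submodules are predicates M -> Prop. *)
Section Modules.
Variables (F : fieldType) (gT : finGroupType).

Section Submodules.
Variables (M : lmodType F) (act : gT -> M -> M).

Definition fixed_points : M -> Prop := fun m => forall g, act g m = m.

Definition cyclic_submodule (m : M) : M -> Prop :=
  fun x => exists a : gT -> F, x = \sum_(g : gT) a g *: act g m.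

Definition span2 (u v : M) : M -> Prop :=
  fun x => exists a b : F, x = a *: u + b *: v.

Definition direct_sum (W U1 U2 : M -> Prop) : Prop :=
  (forall x, W x <-> exists u1 u2, [/\ U1 u1, U2 u2 & x = u1 + u2]) /\
  (forall x, U1 x -> U2 x -> x = 0).

(* The submodule W of M is isomorphic to the module N: an injective          *)
(* equivariant linear map N -> M with image W.                               *)
Definition submodule_iso (W : M -> Prop) (N : lmodType F)
    (actN : gT -> N -> N) : Prop :=
  exists f : {linear N -> M},
    [/\ injective f,
        forall g v, f (actN g v) = act g (f v)
      & forall x, W x <-> exists v, x = f v].

End Submodules.

Definition sum_act (M N : lmodType F) (actM : gT -> M -> M)
    (actN : gT -> N -> N) : gT -> (M * N)%type -> (M * N)%type :=
  fun g v => (actM g v.1, actN g v.2).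

End Modules.

(* The group G acts on V = 'cV[F]_n by v |-> rho g *m v.  A linear form is   *)
(* the row vector of its coordinates, phi : v |-> phi *m v, and S(V^* ) is   *)
(* {mpoly F[n]}, the variable 'X_i being the i-th coordinate function.       *)
Section Coinvariants.
Variables (F : fieldType) (gT : finGroupType) (n : nat).
Variable rho : gT -> 'M[F]_n.

Definition vec_act (g : gT) (v : 'cV[F]_n) : 'cV[F]_n := rho g *m v.

Definition dual_act (g : gT) (phi : 'rV[F]_n) : 'rV[F]_n :=
  phi *m rho (g^-1)%g.

Definition linear_form (phi : 'rV[F]_n) : {mpoly F[n]} :=
  \sum_(i < n) phi 0 i *: 'X_i.

Definition poly_act (g : gT) (f : {mpoly F[n]}) : {mpoly F[n]} :=
  f \mPo [tuple linear_form (dual_act g (delta_mx 0 i)) | i < n].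

Definition invariant (f : {mpoly F[n]}) : Prop := forall g, poly_act g f = f.

Definition hilbert_gen (h : {mpoly F[n]}) : Prop :=
  exists d, [/\ (0 < d)%N, h \is d.-homog & invariant h].

Definition hilbert_ideal : {pred {mpoly F[n]}} :=
  fun f => `[< exists k (a h : 'I_k -> {mpoly F[n]}),
    (forall i, hilbert_gen (h i)) /\ f = \sum_(i < k) a i * h i >].

Lemma hilbert_ideal_closed : idealr_closed hilbert_ideal.
Proof.
split.
- apply/asboolP; exists 0%N, (fun=> 0), (fun=> 0); split; last by rewrite big_ord0.
  by case.
- apply/negP => /asboolP[k [a [h [hh E]]]].
  have := congr1 (mcoeff 0%MM) E.
  rewrite mcoeff1 eqxx raddf_sum /= big1 => [/eqP|i _]; first by rewrite oner_eq0.
  have [d [d0 hd _]] := hh i.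
  rewrite rmorphM /= (dhomog_nemf_coeff hd) ?mulr0 //.
  by rewrite /= mdeg0 eq_sym -lt0n.
- move=> c f1 f2 /asboolP[k1 [a1 [h1 [H1 ->]]]] /asboolP[k2 [a2 [h2 [H2 ->]]]].
  apply/asboolP; exists (k1 + k2)%N.
  exists (fun i => match split i with inl j => c * a1 j | inr j => a2 j end).
  exists (fun i => match split i with inl j => h1 j | inr j => h2 j end).
  split; first by move=> i; case: (split i).
  rewrite big_split_ord /= mulr_sumr; congr (_ + _); apply: eq_bigr => i _.
    by rewrite (unsplitK (inl i)) mulrA.
  by rewrite (unsplitK (inr i)).
Qed.

HB.instance Definition _ :=
  isIdealr.Build {mpoly F[n]} hilbert_ideal hilbert_ideal_closed.

Definition coinv : Type := {ideal_quot hilbert_ideal}.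

HB.instance Definition _ := GRing.ComNzRing.on coinv.

Definition coinv_pi (f : {mpoly F[n]}) : coinv := \pi_{ideal_quot hilbert_ideal} f.

Definition coinv_scale (a : F) (c : coinv) : coinv := coinv_pi a%:MP * c.

Lemma coinv_pi_is_zmod_morphism : zmod_morphism coinv_pi.
Proof. exact: raddfB. Qed.

Lemma coinv_pi_is_monoid_morphism : monoid_morphism coinv_pi.
Proof. by split; [exact: rmorph1 | exact: rmorphM]. Qed.

HB.instance Definition _ :=
  GRing.isZmodMorphism.Build {mpoly F[n]} coinv coinv_pi coinv_pi_is_zmod_morphism.
HB.instance Definition _ :=
  GRing.isMonoidMorphism.Build {mpoly F[n]} coinv coinv_pi
    coinv_pi_is_monoid_morphism.

Lemma coinv_scaleA a b c :
  coinv_scale a (coinv_scale b c) = coinv_scale (a * b) c.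
Proof. by rewrite /coinv_scale mulrA -rmorphM /= -mpolyCM. Qed.

Lemma coinv_scale1 : left_id 1 coinv_scale.
Proof. by move=> c; rewrite /coinv_scale mpolyC1 rmorph1 mul1r. Qed.

Lemma coinv_scaleDr : right_distributive coinv_scale +%R.
Proof. by move=> a c d; rewrite /coinv_scale mulrDr. Qed.

Lemma coinv_scaleDl c : {morph coinv_scale^~ c : a b / a + b}.
Proof. by move=> a b; rewrite /coinv_scale mpolyCD rmorphD mulrDl. Qed.

HB.instance Definition _ := GRing.Zmodule_isLmodule.Build F coinv
  coinv_scaleA coinv_scale1 coinv_scaleDr coinv_scaleDl.

Lemma coinv_scaleAl (a : F) (c d : coinv) : a *: (c * d) = (a *: c) * d.
Proof. exact: mulrA. Qed.

HB.instance Definition _ := GRing.Lmodule_isLalgebra.Build F coinv coinv_scaleAl.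

Lemma coinv_pi_is_scalable : scalable coinv_pi.
Proof. by move=> a f; rewrite -mul_mpolyC rmorphM. Qed.

HB.instance Definition _ :=
  GRing.isScalable.Build F {mpoly F[n]} coinv *:%R coinv_pi coinv_pi_is_scalable.

Definition coinv_act (g : gT) (c : coinv) : coinv :=
  coinv_pi (poly_act g (repr c)).

Definition coinv_deg (d : nat) : coinv -> Prop :=
  fun c => exists2 f : {mpoly F[n]}, f \is d.-homog & c = coinv_pi f.

End Coinvariants.

Arguments coinv_pi {F gT n} rho f.
Arguments coinv_act {F gT n} rho g c.
Arguments coinv_deg {F gT n} rho d c.

Definition jordan_block (F : fieldType) (n : nat) : 'M[F]_n :=
  \matrix_(i, j) ((i == j)%:R + (i.+1 == j)%:R).

(* 'Z_p is used as an additive group, with generator 1.                      *)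
Definition Zp_gen (p : nat) : 'Z_p := 1.

(* For n <= p and F of characteristic p this is a representation of 'Z_p,    *)
(* see V_rho_repr below.                                                     *)
Definition V_rho (F : fieldType) (p n : nat) : 'Z_p -> 'M[F]_n :=
  fun g => jordan_block F n ^+ g.

Arguments V_rho F p n g : clear implicits.

Definition V_act (F : fieldType) (p n : nat) : 'Z_p -> 'cV[F]_n -> 'cV[F]_n :=
  vec_act (V_rho F p n).

Arguments V_act F p n g v : clear implicits.

(* The generator acts on V_n = 'cV[F]_n by jordan_block F n; Delta is the    *)
(* generator minus the identity on the dual space.                           *)
Definition Delta (F : fieldType) (p n : nat) (phi : 'rV[F]_n) : 'rV[F]_n :=
  dual_act (V_rho F p n) (Zp_gen p) phi - phi.

Lemma V_rho_repr (F : fieldType) (p n : nat) : p \in [pchar F] -> (n <= p)%N ->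
  mx_repr [set: 'Z_p] (V_rho F p n).
Proof.
move=> charFp le_n_p; have p_pr := pcharf_prime charFp.
suff Jp : jordan_block F n ^+ p = 1.
  split=> [|x y _ _]; rewrite /V_rho; first by rewrite expr0.
  have E : nat_of_ord (x * y)%g = ((x + y) %% p)%N.
    by rewrite /=; congr (_ %% _)%N; rewrite Zp_cast ?prime_gt1.
  rewrite mulmxE -exprD E [in RHS](divn_eq (x + y)%N p).
  by rewrite exprD mulnC exprM Jp expr1n mul1r.
case: n le_n_p => [|n] le_n_p; first by rewrite [LHS]flatmx0 [RHS]flatmx0.
pose N : 'M[F]_n.+1 := \matrix_(i, j) (i.+1 == j)%:R.
have -> : jordan_block F n.+1 = 1 + N by apply/matrixP => i j; rewrite !mxE.
have NX k : N ^+ k = \matrix_(i, j) ((i + k)%N == j)%:R.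
  elim: k => [|k IHk]; first by apply/matrixP => i j; rewrite expr0 !mxE addn0.
  apply/matrixP => i j; rewrite exprS IHk -mulmxE !mxE.
  have [lt_i|ge_i] := ltnP i.+1 n.+1.
    rewrite (bigD1 (Ordinal lt_i)) //= !mxE /= eqxx mul1r addSnnS big1 ?addr0 //.
    move=> l ne_l; rewrite !mxE; case: eqP => [E|]; last by rewrite mul0r.
    by case/eqP: ne_l; apply: val_inj; rewrite /= E.
  rewrite big1 => [|l _]; last first.
    by rewrite !mxE; case: eqP => [E|]; rewrite ?mul0r //; move: ge_i; rewrite E leqNgt ltn_ord.
  case: eqP => // E; have := ltn_ord j; rewrite -E ltnNge.
  by rewrite (leq_trans ge_i) // addnS ltnS leq_addr.
have charM : p \in [pchar 'M[F]_n.+1] by rewrite (GRing.pchar_lalg 'M[F]_n.+1).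
rewrite -(pFrobenius_autE charM) pFrobenius_autD_comm ?pFrobenius_aut1; last exact/commr_sym/commr1.
rewrite pFrobenius_autE NX -[RHS]addr0; congr (_ + _).
apply/matrixP => i j; rewrite !mxE; case: eqP => // E.
by have := ltn_ord j; rewrite -E ltnNge (leq_trans le_n_p) ?leq_addl.
Qed.

Section ActionLemmas.
Variables (F : fieldType) (gT : finGroupType) (n : nat) (rho : gT -> 'M[F]_n).

Lemma linear_form_is_linear : linear (@linear_form F n).
Proof.
move=> a u v; rewrite /linear_form scaler_sumr -big_split /=; apply: eq_bigr => i _.
by rewrite !mxE scalerDl scalerA.
Qed.

Lemma poly_act_linear_form g phi :
  poly_act rho g (linear_form phi) = linear_form (dual_act rho g phi).
Proof.
rewrite /poly_act [in LHS]/linear_form raddf_sum /=.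
pose L : {linear 'rV[F]_n -> {mpoly F[n]}} := HB.pack (@linear_form F n)
  (GRing.isLinear.Build _ _ _ _ _ linear_form_is_linear).
rewrite -[RHS]/(L _) [in RHS](row_sum_delta phi) /dual_act mulmx_suml linear_sum.
apply: eq_bigr => i _; rewrite comp_mpolyZ comp_mpolyXU -tnth_nth tnth_mktuple.
by rewrite -scalemxAl linearZ.
Qed.

Lemma poly_act_hilbert g f :
  f \in hilbert_ideal rho -> poly_act rho g f \in hilbert_ideal rho.
Proof.
move=> /asboolP[k [a [h [hh ->]]]]; apply/asboolP.
exists k, (fun i => poly_act rho g (a i)), h; split=> //.
rewrite /poly_act raddf_sum; apply: eq_bigr => i _.
have [d [_ _ hinv]] := hh i.
by rewrite /= rmorphM -[X in _ * X]/(poly_act rho g (h i)) hinv.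
Qed.

Lemma coinv_actE g f :
  coinv_act rho g (coinv_pi rho f) = coinv_pi rho (poly_act rho g f).
Proof.
rewrite /coinv_act /coinv_pi; apply/eqP; rewrite -Quotient.idealrBE.
rewrite /poly_act -raddfB; apply: poly_act_hilbert.
by rewrite Quotient.idealrBE reprK.
Qed.

End ActionLemmas.

(* Main.v *)
From HB Require Import structures.
Require Import Defs.
From mathcomp Require Import all_boot all_order all_fingroup all_algebra.
From mathcomp Require Import generic_quotient ring_quotient mpoly.
From mathcomp Require Import ring zify.

Set Implicit Arguments.
Unset Strict Implicit.
Unset Printing Implicit Defensive.

Import GRing.Theory.
Local Open Scope ring_scope.

(**
In coordinates X1, ..., X4 the Hilbert ideal is the monomial ideal
(X1, X2^2, X2 X3^(p-3), X3^(p-1), X4^p).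

It contains these monomials: X1 and X2^2 - 2 X1 X3 - X1 X2 are invariant; Delta^(p-1) X4^(p-2)
and Delta^(p-1) X4^(p-1) are invariant because Delta^p = sigma^p - 1 = 0, and modulo X1 and X2^2
they are multiples of X2 X3^(p-3) and X3^(p-1); finally X4 is a root of the product of the
T - sigma^k X4, whose non-leading coefficients are invariants of positive degree.

Conversely no monomial outside this ideal occurs in an invariant f of positive degree d. On the line (0, 0, 1, t)
the values of f and of its derivative along X2 satisfy difference equations in t, which reduce the
claim to the coefficients of X3^d and X2 X3^(d-1). These vanish when d <= p - 2, resp. d <= p - 3:
for each k in the prime field, sigma^k carries a tangent vector at (0, 2, 1 - k, 0) to one at
(0, 2, 1 + k, 0), and comparing the directional derivatives of f gives a polynomial identity in k
of degree less than p.

In the coinvariants sigma^k (x3^a x4^b) is a polynomial in k, so Delta^n (x3^a x4^b) is n! times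
its n-th coefficient as soon as its degree is at most n. This gives the lengths and the socles of
the Jordan chains of the proposed generators. The socles are independent, hence so are the chains,
and they fill the component by counting the monomials outside the ideal.
*)

(** * Finite differences *)

Lemma coef_linear_exp (A : comNzRingType) (u v : A) b k :
  ((u%:P + v *: 'X) ^+ b)`_k = (u ^+ (b - k) * v ^+ k) *+ 'C(b, k).
Proof.
rewrite exprDn coef_sum.
have E (i : nat) : ((u%:P ^+ (b - i) * (v *: 'X) ^+ i) *+ 'C(b, i))`_k =
    if i == k then (u ^+ (b - k) * v ^+ k) *+ 'C(b, k) else 0.
  rewrite coefMn -polyC_exp coefCM exprZn coefZ coefXn eq_sym.
  by case: eqP => [->|_]; rewrite ?mulr1 // !mulr0 mul0rn.
under eq_bigr do rewrite E.
case: (ltnP k b.+1) => [ltk|gek].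
  rewrite (bigD1 (Ordinal ltk)) //= eqxx big1 ?addr0 // => i.
  by rewrite -val_eqE /= => /negbTE ->.
by rewrite bin_small // mulr0n big1 // => i _; case: eqP.
Qed.

(** Only the term of degree n of P reaches degree n after a linear substitution, and nothing goes
    beyond. *)
Lemma coef_comp_linear (A : comNzRingType) (P : {poly A}) (c : A) n k :
  (size P <= n.+1)%N -> (n <= k)%N ->
  (P \Po (1 + c *: 'X))`_k = if k == n then c ^+ n * P`_n else 0.
Proof.
move=> leP lek; rewrite comp_polyE.
rewrite (big_ord_widen n.+1 (fun i => P`_i *: (1 + c *: 'X) ^+ i) leP).
rewrite big_mkcond coef_sum /= (eq_bigr (fun i : 'I_n.+1 => P`_i * (c ^+ k *+ 'C(i, k)))) => [|i _].
  rewrite big_ord_recr big1 /= => [|i _]; last by rewrite bin_small ?mulr0n ?mulr0 //; have := ltn_ord i; lia.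
  rewrite add0r; case: eqP => [->|ne]; first by rewrite binn mulr1n mulrC.
  by rewrite bin_small ?mulr0n ?mulr0 //; lia.
case: ifP => lti; last by rewrite coef0 nth_default ?mul0r // leqNgt lti.
by rewrite coefZ -[X in X + _]/(1%:P) coef_linear_exp expr1n mul1r.
Qed.

Section FiniteDifferences.
Variable A : comNzRingType.
Implicit Types (P : {poly A}) (T : {additive A -> A}) (g : A).

Definition fdiff P := P \Po ('X + 1) - P.

Lemma coef_comp_XD1 P n k : (size P <= n)%N ->
  (P \Po ('X + 1))`_k = \sum_(i < n) P`_i *+ 'C(i, k).
Proof.
move=> leP; rewrite comp_polyE.
rewrite (big_ord_widen n (fun i => P`_i *: ('X + 1) ^+ i) leP).
rewrite big_mkcond /= coef_sum; apply: eq_bigr => i _.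
have -> : (if (i < size P)%N then P`_i *: ('X + 1) ^+ i else 0) = P`_i *: ('X + 1) ^+ i.
  by case: ltnP => // ?; rewrite nth_default // scale0r.
rewrite coefZ addrC -[X in X + 'X]/(1%:P) -['X]scale1r coef_linear_exp.
by rewrite !expr1n mulr1 mulr_natr.
Qed.

Lemma coef_fdiff_ge P n k : (size P <= n.+1)%N -> (n <= k)%N -> (fdiff P)`_k = 0.
Proof.
move=> leP lek; rewrite /fdiff coefB (coef_comp_XD1 _ leP) big_ord_recr /= big1.
  rewrite add0r; case: (ltngtP n k) lek => // [ltk|<-] _.
    by rewrite bin_small // (nth_default _ (leq_trans leP ltk)) subr0.
  by rewrite binn subrr.
by move=> i _; rewrite bin_small // (leq_trans (ltn_ord i)).
Qed.

Lemma size_fdiff P n : (size P <= n.+1)%N -> (size (fdiff P) <= n)%N.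
Proof. by move=> leP; apply/leq_sizeP => k; apply: coef_fdiff_ge. Qed.

Lemma coef_fdiff P n : (size P <= n.+2)%N -> (fdiff P)`_n = P`_n.+1 *+ n.+1.
Proof.
move=> leP; rewrite /fdiff coefB (coef_comp_XD1 _ leP) !big_ord_recr /= big1.
  by rewrite binn binSn add0r mulr1n addrAC subrr add0r.
by move=> i _; rewrite bin_small.
Qed.

(** On interpolated orbits T - 1 becomes the forward difference, which lowers the degree by one and
    multiplies the top coefficient by the degree; n steps leave n! times the coefficient of degree
    n. *)
Lemma iter_diff_interpolated T P g n :
  (forall k, iter k T g = P.[k%:R]) -> (size P <= n.+1)%N ->
  iter n (fun x => T x - x) g = P`_n *+ n`!.
Proof.
elim: n P g => [|n IHn] P g TP leP.
  by rewrite /= -[g]/(iter 0 T g) TP (size1_polyC leP) hornerC coefC.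
rewrite iterSr (IHn (fdiff P)) ?size_fdiff ?coef_fdiff // => [|k].
  by rewrite -mulrnA factS.
have TB m x y : iter m T (x - y) = iter m T x - iter m T y.
  by elim: m => //= m ->; rewrite raddfB.
rewrite TB -iterSr !TP /fdiff hornerD hornerN horner_comp !hornerE.
by rewrite -natr1.
Qed.

End FiniteDifferences.

(** * Jordan chains of monomials in x2, x3, x4 when x2^2 = 0 *)

Section UnipotentChain.
Variables (F : fieldType) (A : comAlgType F) (T : {lrmorphism A -> A}).
Variables (x2 x3 x4 : A).
Hypotheses (F2 : 2%:R != 0 :> F) (x2x2 : x2 * x2 = 0).
Hypotheses (Tx2 : T x2 = x2) (Tx3 : T x3 = x3 + x2) (Tx4 : T x4 = x4 + x3).

Local Notation half := (2%:R^-1 : F).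

(* Interpolates k |-> T^k (x3^a x4^b), see [iter_chain]. *)
Definition chain_poly a b : {poly A} :=
  (x3%:P + x2 *: 'X) ^+ a * (x4%:P + x3 *: 'X + (half *: x2) *: ('X^2 - 'X)) ^+ b.

Lemma half2 (k : nat) : half *+ (k * 2) = k%:R.
Proof. by rewrite -[LHS]mulr_natr natrM mulrC mulfK. Qed.

(** Since x2 is fixed, T^k x3 = x3 + k x2 and T^k x4 = x4 + k x3 + (k(k-1)/2) x2; multiplicativity
    of T does the rest. *)
Lemma iter_chain a b k : iter k T (x3 ^+ a * x4 ^+ b) = (chain_poly a b).[k%:R].
Proof.
have E3 j : iter j T x3 = x3 + x2 *+ j.
  elim: j => [|j /= ->]; first by rewrite addr0.
  by rewrite raddfD raddfMn /= Tx3 Tx2 mulrS addrA.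
have E4 j : iter j T x4 = x4 + x3 *+ j + half *: x2 *+ (j * j.-1).
  elim: j => [|j IHj]; first by rewrite /= !addr0.
  have -> : (j.+1 * j.+1.-1 = j * j.-1 + j * 2)%N by case: j {IHj} => //= j; lia.
  rewrite iterS IHj !raddfD !raddfMn /= linearZ /= Tx2 Tx3 Tx4.
  by rewrite [X in _ = _ + (_ + X)]scalerMnl half2 scaler_nat; ring.
have TM j x y : iter j T (x * y) = iter j T x * iter j T y.
  by elim: j => //= j ->; rewrite rmorphM.
have TX j x n : iter j T (x ^+ n) = iter j T x ^+ n.
  elim: n => [|n IHn]; last by rewrite !exprS TM IHn.
  by rewrite !expr0; elim: j => //= j ->; rewrite rmorph1.
rewrite TM !TX E3 E4 /chain_poly !hornerE.
congr (_ ^+ _ * (_ + _) ^+ _); rewrite ?mulr_natr //.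
rewrite -[LHS]mulr_natr; congr (_ * _).
by case: k => [|k]; rewrite natrM -?natr1 /=; ring.
Qed.

Local Notation lin b n := ((x4 ^+ (b - n) * x3 ^+ n) *+ 'C(b, n)).

Lemma exprD_sqr0 (R : comNzRingType) (x y : R) n :
  y * y = 0 -> (x + y) ^+ n = x ^+ n + y * x ^+ n.-1 *+ n.
Proof.
move=> y0; elim: n => [|n IHn]; first by rewrite !expr0 mulr0n addr0.
rewrite exprS IHn mulrDl !mulrDr -exprS /= -addrA; congr (_ + _).
have -> : y * (y * x ^+ n.-1 *+ n) = 0 by rewrite mulrnAr mulrA y0 mul0r mul0rn.
case: n {IHn} => [|n]; first by rewrite mulr0n mulr0 add0r addr0.
by rewrite addr0 /= mulrnAr mulrCA -exprS -mulrSr.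
Qed.

(** As x2^2 = 0, the product is affine in x2. The three summands are the part free of x2, the part
    with x2 from one factor T^k x3, and the part with x2 from one factor T^k x4. *)
Lemma coef_chain_poly a b n :
  (chain_poly a b)`_n = x3 ^+ a * lin b n
    + (if (0 < n)%N then x2 * x3 ^+ a.-1 * lin b n.-1 *+ a else 0)
    + half *: (x2 * x3 ^+ a * ((if (1 < n)%N then lin b.-1 n.-2 else 0)
                 - (if (0 < n)%N then lin b.-1 n.-1 else 0))) *+ b.
Proof.
pose L : {poly A} := x4%:P + x3 *: 'X.
have E : chain_poly a b = (x3 ^+ a)%:P * L ^+ b
    + (x2 * x3 ^+ a.-1 *+ a)%:P * (L ^+ b * 'X)
    + (half *: (x2 * x3 ^+ a) *+ b)%:P * (L ^+ b.-1 * 'X * 'X - L ^+ b.-1 * 'X).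
  rewrite /chain_poly -/L (exprD_sqr0 L) ?(exprD_sqr0 x3%:P); last 2 first.
  - by rewrite -scalerAl -scalerAr scalerA x2x2 scale0r.
  - have c0 : (half *: x2) * (half *: x2) = 0 by rewrite -scalerAl -scalerAr x2x2 !scaler0.
    by set c := half *: x2 in c0 *; rewrite -scalerAl -scalerAr scalerA c0 scale0r.
  have s0 : x2%:P * x2%:P = 0 :> {poly A} by rewrite -polyCM x2x2.
  rewrite -!mul_polyC -[half *: x2]mulr_algl -[half *: (x2 * _)]mulr_algl.
  rewrite !(polyCMn, polyCM, polyC_exp).
  set h := (half%:A)%:P; set l := L ^+ b; set m := L ^+ _.
  set u := x3%:P ^+ a; set v := x3%:P ^+ _; set s := x2%:P in s0 *.
  (* The product of the two corrections is a multiple of x2^2. Subtracting it explicitly turns the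
     claim into a polynomial identity. *)
  rewrite -[LHS]subr0 -[X in _ - X](mul0r (h * 'X * v * ('X^2 - 'X) * m *+ a *+ b)) -s0.
  ring.
rewrite E !coefD !coefCM coefB !coefMX !coef_linear_exp.
rewrite !mulrnAl -!scalerAl.
by case: n => [|[|n]] //=; rewrite !mulr0 !mul0rn ?sub0r ?subr0 ?addr0.
Qed.

Local Notation D := (fun x : A => T x - x).

(** The factor x2 kills both corrections in [coef_chain_poly]. *)
Lemma coef_x2_chain_poly a b n :
  (x2 *: chain_poly a b)`_n = (x2 * x3 ^+ (a + n) * x4 ^+ (b - n)) *+ 'C(b, n).
Proof.
have x2k y z : x2 * (x2 * y * z) = 0 by rewrite !mulrA x2x2 !mul0r.
rewrite coefZ coef_chain_poly mulrDr [in X in X + _]mulrDr.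
rewrite [x2 * (if _ then _ else _)](_ : _ = 0); last first.
  by case: ifP => _; rewrite ?mulr0 // mulrnAr x2k mul0rn.
rewrite [x2 * (_ *: _ *+ b)](_ : _ = 0); last first.
  by rewrite mulrnAr -scalerAr x2k scaler0 mul0rn.
by rewrite !addr0 exprD !mulrnAr !mulrA mulrAC.
Qed.

Lemma iterD_x2_chain a b n : (forall k, (n < k)%N -> (x2 *: chain_poly a b)`_k = 0) ->
  iter n D (x2 * x3 ^+ a * x4 ^+ b) =
    (x2 * x3 ^+ (a + n) * x4 ^+ (b - n)) *+ ('C(b, n) * n`!).
Proof.
move=> P0; rewrite (iter_diff_interpolated (P := x2 *: chain_poly a b) (n := n)).
- by rewrite coef_x2_chain_poly mulrnA.
- move=> k; rewrite hornerZ -iter_chain -mulrA.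
  by elim: k => //= k ->; rewrite [LHS]rmorphM /= Tx2.
- by apply/leq_sizeP.
Qed.

Lemma iterD_chain a b n : (forall k, (n < k)%N -> (chain_poly a b)`_k = 0) ->
  iter n D (x3 ^+ a * x4 ^+ b) = (chain_poly a b)`_n *+ n`!.
Proof.
by move=> P0; apply: iter_diff_interpolated; [exact: iter_chain | apply/leq_sizeP].
Qed.

Lemma coef_x4_gt d k : (0 < d)%N -> (d.+1 < k)%N -> (chain_poly 0 d)`_k = 0.
Proof.
case: d => // d _ ltk.
rewrite coef_chain_poly !bin_small ?(mulr0, mulr0n, mul0rn, if_same, subr0, scaler0, addr0) //; lia.
Qed.

(** The term of degree d + 1 in k arises by taking the quadratic part (k^2/2) x2 from one of the d
    factors and k x3 from the others; two quadratic parts would give x2^2 = 0. *)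
Lemma iterD_x4 d : (0 < d)%N -> iter d.+1 D (x4 ^+ d) =
  (half * (d * d.+1`!)%:R) *: (x2 * x3 ^+ d.-1).
Proof.
move=> d0; rewrite -[x4 ^+ _]mul1r -(expr0 x3) iterD_chain; last by move=> k; apply: coef_x4_gt.
case: d d0 => // d _.
rewrite coef_chain_poly /= bin_small // !binn bin_small // !mulr0n !subnn.
rewrite !expr0 !mul1r !add0r subr0 mulr1n mulr1 -mulrnA scalerMnl.
by rewrite -[half *+ _]mulr_natr.
Qed.

Lemma iterD_x4_eq0 d : (0 < d)%N -> iter d.+2 D (x4 ^+ d) = 0.
Proof.
move=> d0; rewrite -[x4 ^+ _]mul1r -(expr0 x3) iterD_chain ?coef_x4_gt ?mul0rn //.
by move=> k /ltnW; apply: coef_x4_gt.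
Qed.

(** The hypothesis removes every x2 term of degree at least d in k, so the top term is that of (x4 +
    k x3)^d. This yields the relation on powers of x3 once x2 x3^(p-3) = 0 is known. *)
Lemma iterD_x4_top d : (1 < d)%N -> x2 * x3 ^+ d.-2 = 0 ->
  iter d D (x4 ^+ d) = x3 ^+ d *+ d`!.
Proof.
case: d => [|[|d]] // _; rewrite [d.+2.-2]/= => R; have R1 : x2 * x3 ^+ d.+1 = 0 by rewrite exprSr mulrA R mul0r.
rewrite -[x4 ^+ _]mul1r -(expr0 x3) (@iterD_chain 0 d.+2 d.+2) => [|k ltk].
  rewrite coef_chain_poly /= !binn !subnn subSnn !expr0 !mul1r mulr0n addr0 mulr1.
  by rewrite mulrBr !mulrnAr mulrCA R R1 mulr0 !mul0rn subr0 scaler0 mul0rn addr0.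
rewrite coef_chain_poly bin_small // mulr0n mulr0 add0r mulr0n if_same add0r.
case: k ltk => [|[|[|k]]] //= ltk; rewrite expr0 mulr1.
rewrite (@bin_small d.+1 k.+2) // subr0; case: (ltngtP k d) => ltdk; [lia| |].
  by rewrite bin_small // mulr0n mulr0 scaler0 mul0rn.
by rewrite ltdk binn mulr1n mulrCA R1 mulr0 scaler0 mul0rn.
Qed.

Lemma lin2E i m k :
  x2 * x3 ^+ i * lin m k = (x2 * x3 ^+ (i + k) * x4 ^+ (m - k)) *+ 'C(m, k).
Proof. by rewrite mulrnAr exprD [x4 ^+ _ * _]mulrC !mulrA. Qed.

(** The scalar (d+4)/2 is forced: in degree d + 1 the orbit of x3^2 x4^d contributes 2 + d/2 times
    x2 x3^(d+1), and that of x2 x4^(d+1) contributes it once. After the cancellation the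
    interpolating polynomial has degree at most d. *)
Lemma iterD_second d (w := x3 ^+ 2 * x4 ^+ d - (half * (d + 4)%:R) *: (x2 * x4 ^+ d.+1)) :
  iter d D w = (x3 ^+ d.+2 - d.+2%:R *: (x2 * x3 ^+ d * x4)
                - (half * d%:R) *: (x2 * x3 ^+ d.+1)) *+ d`! /\
  iter d.+1 D w = 0.
Proof.
pose c := half * (d + 4)%:R.
pose P := chain_poly 2 d - c%:A *: (x2 *: chain_poly 0 d.+1).
have TP k : iter k T w = P.[k%:R].
  rewrite hornerD hornerN !hornerZ -!iter_chain mulr_algl expr0 mul1r.
  rewrite /w -/c; elim: k => //= k ->.
  by rewrite raddfB /= linearZ /= rmorphM /= Tx2.
have coefP k : P`_k = x3 ^+ 2 * lin d k
    + (if (0 < k)%N then (x2 * x3 ^+ k * x4 ^+ (d - k.-1)) *+ 'C(d, k.-1) *+ 2 else 0)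
    + half *: ((if (1 < k)%N then (x2 * x3 ^+ k * x4 ^+ (d.-1 - k.-2)) *+ 'C(d.-1, k.-2) else 0)
        - (if (0 < k)%N then (x2 * x3 ^+ k.+1 * x4 ^+ (d.-1 - k.-1)) *+ 'C(d.-1, k.-1) else 0)) *+ d
    - c *: ((x2 * x3 ^+ k * x4 ^+ (d.+1 - k)) *+ 'C(d.+1, k)).
  rewrite coefB coef_chain_poly coefZ mulr_algl coef_x2_chain_poly add0n.
  rewrite mulrBr !(fun_if (fun z => _ * z)) !lin2E !mulr0.
  by case: k => [|[|k]].
have P0 k : (d < k)%N -> P`_k = 0.
  move=> ltk; rewrite coefP bin_small // mulr0n mulr0 add0r.
  (* The case d = 0 is separate because [d.-1] is truncated there; the factor d then kills that
     summand. *)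
  case: d @w @c @P TP coefP ltk => [|d] w c P TP coefP ltk.
    rewrite mulr0n addr0; case: k ltk => // -[|k] _ /=.
      by rewrite !bin0 !mulr1n /c add0n (natrM _ 2 2) mulKf // scaler_nat subrr.
    by rewrite !bin_small // mulr0n mul0rn scaler0 subr0.
  case: k ltk => // -[|k] // ltk; rewrite /= !ltnS in ltk *.
  case: (ltngtP d k) ltk => // [ltk _|<- _].
    rewrite !bin_small ?mulr0n ?mul0rn ?subr0 ?scaler0 ?mul0rn ?addr0 ?oppr0 ?addr0 //; lia.
  rewrite !binn (@bin_small d) // !subnn !mulr1n mulr0n subr0 mulr1.
  set X := x2 * _; rewrite scalerMnl -[X *+ 2]scaler_nat -!scalerDl -scalerBl.
  rewrite [X in X *: _](_ : _ = 0) ?scale0r // /c -[half *+ _]mulr_natr.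
  rewrite natrD [4%:R](natrM _ 2 2) mulrDr mulKf // addrC; ring.
split; last by rewrite (iter_diff_interpolated TP) ?P0 ?mul0rn //; apply/leq_sizeP => k /ltnW; exact: P0.
rewrite (iter_diff_interpolated TP); last by apply/leq_sizeP.
congr (_ *+ _); rewrite coefP binn subnn mulr1n expr0 mul1r -exprD subSnn.
case: d @w @c @P TP coefP P0 => [|d] w c P TP coefP P0.
  by rewrite /= !bin0 !mulr0n mulr0 scale0r !addr0 subr0 /c add0n (natrM _ 2 2) mulKf // mulr1n.
rewrite [if (1 < _)%N then _ else _](_ : _ = (x2 * x3 ^+ d.+1 * x4) *+ d); last first.
  by case: (d) => // m; rewrite /= binSn subSnn expr1.
rewrite /= !binSn subSnn binn subnn mulr1n mulr1 !expr1.
set Z := x3 ^+ _; set V := x2 * _ * x4; set Y := x2 * _.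
rewrite -mulrnA scalerMnr mulrnBl -mulrnA -[V *+ _]scaler_nat -[V *+ (d * _)]scaler_nat.
rewrite -[Y *+ _]scaler_nat -[V *+ _]scaler_nat scalerBr !scalerA.
(* This compares the coefficients of [V]; after the case split, d stands for the former d - 1. *)
have -> : d.+3%:R = c * d.+2%:R - half * (d * d.+1)%:R - (d.+1 * 2)%:R.
  have [-> -> ->] : [/\ d.+3%:R = d%:R + 3%:R :> F, d.+2%:R = d%:R + 2%:R :> F
      & c = half * (d%:R + 5%:R)].
    by split; rewrite ?/c -natrD ?addn3 ?addn2 // addSnnS.
  by rewrite !natrM -[d.+1%:R]natr1; field.
rewrite !scalerBl; ring.
Qed.

(** * Chains under the relations x2 x3^(e+1) = 0 and x3^(e+3) = 0, applied with e = p - 4 *)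

Section TopDegrees.
Variable e : nat.
Hypotheses (R2 : x2 * x3 ^+ e.+1 = 0) (R3 : x3 ^+ e.+3 = 0).

Lemma x2x3_eq0 k y : (e < k)%N -> x2 * x3 ^+ k * y = 0.
Proof. by move=> ltk; rewrite -(subnKC ltk) exprD mulrA R2 !mul0r. Qed.

Lemma x3_eq0 k y : (e.+2 < k)%N -> x3 ^+ k * y = 0.
Proof. by move=> ltk; rewrite -(subnKC ltk) exprD R3 !mul0r. Qed.

Lemma iterD_x2_top a b n : (a + n = e)%N ->
  iter n D (x2 * x3 ^+ a * x4 ^+ b) = (x2 * x3 ^+ e * x4 ^+ (b - n)) *+ ('C(b, n) * n`!).
Proof.
move=> an; rewrite -[in RHS]an; apply: iterD_x2_chain => k ltk.
rewrite coef_x2_chain_poly x2x3_eq0 ?mul0rn //; lia.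
Qed.

Lemma iterD_x2_top_eq0 a b n : (a + n = e)%N -> iter n.+1 D (x2 * x3 ^+ a * x4 ^+ b) = 0.
Proof.
move=> an; rewrite iterD_x2_chain => [|k ltk]; first by rewrite x2x3_eq0 ?mul0rn //; lia.
by rewrite coef_x2_chain_poly x2x3_eq0 ?mul0rn //; lia.
Qed.

Lemma lin3E a b m : x3 ^+ a * lin b m = (x3 ^+ (a + m) * x4 ^+ (b - m)) *+ 'C(b, m).
Proof. by rewrite mulrnAr exprD [x4 ^+ _ * _]mulrC mulrA. Qed.

(** The coefficient of degree k consists of multiples of x3^(a+k), x2 x3^(a+k-2) and x2 x3^(a+k-1),
    all zero as soon as a + k > e + 2. *)
Lemma coef_chain_poly_gt a b n k : (a + n = e.+2)%N -> (n < k)%N -> (chain_poly a b)`_k = 0.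
Proof.
move=> an ltk; have B0 : x2 * x3 ^+ a.-1 * lin b k.-1 *+ a = 0.
  case: (a) an => [|a'] an; first by rewrite mulr0n.
  by rewrite lin2E x2x3_eq0 ?mul0rn //; lia.
rewrite coef_chain_poly B0 // lin3E x3_eq0; last lia.
rewrite if_same mul0rn addr0 add0r mulrBr !(fun_if (fun z => _ * z)) !lin2E !mulr0.
case: k {B0} ltk => // k; rewrite ltnS [k.+1.-1]/= => lenk.
rewrite (@x2x3_eq0 (a + k)); last lia.
case: k lenk => [|k] lenk; first by rewrite mul0rn subr0 scaler0 mul0rn.
rewrite [k.+2.-2]/= (@x2x3_eq0 (a + k)); last lia.
by rewrite !mul0rn subr0 scaler0 mul0rn.
Qed.

Lemma iterD_top_eq0 a b n : (a + n = e.+2)%N -> iter n.+1 D (x3 ^+ a * x4 ^+ b) = 0.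
Proof.
move=> an; rewrite iterD_chain => [|k /ltnW]; last exact: coef_chain_poly_gt.
by rewrite (coef_chain_poly_gt b an) ?mul0rn.
Qed.

(** The scalar c may stay unspecified: the second chain ends in a multiple of x2 x3^e times a power
    of x4, so the two ends are related to the socle basis by a triangular matrix. *)
Lemma iterD_top a b n : (a + n = e.+2)%N -> (n <= b)%N -> exists c : F,
  iter n D (x3 ^+ a * x4 ^+ b) =
    ('C(b, n) * n`!)%:R *: (x3 ^+ e.+2 * x4 ^+ (b - n)) +
    c *: (x2 * x3 ^+ e * x4 ^+ (b - n).+1).
Proof.
move=> an nb; rewrite iterD_chain; last by move=> k; apply: coef_chain_poly_gt.
rewrite coef_chain_poly lin3E an.
pose z : A := x2 * x3 ^+ e * x4 ^+ (b - n).+1.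
have [c1 ->] : exists c : F, (if (0 < n)%N then x2 * x3 ^+ a.-1 * lin b n.-1 *+ a else 0) = c *: z.
  case: ifP => n0; last by exists 0; rewrite scale0r.
  case: (a) an => [|a'] an; first by exists 0; rewrite mulr0n scale0r.
  exists ('C(b, n.-1) * a'.+1)%:R; rewrite lin2E -mulrnA scaler_nat /z.
  by congr (_ * _ ^+ _ * _ ^+ _ *+ _) => /=; lia.
have [c2 ->] : exists c : F, half *: (x2 * x3 ^+ a *
    ((if (1 < n)%N then lin b.-1 n.-2 else 0) - (if (0 < n)%N then lin b.-1 n.-1 else 0)))
    *+ b = c *: z.
  rewrite mulrBr !(fun_if (fun z => _ * z)) !lin2E !mulr0.
  have [n2|n2] := ltnP 1 n; last first.
    exists 0; rewrite scale0r sub0r; case: ifP => n0; last by rewrite oppr0 scaler0 mul0rn.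
    by rewrite (@x2x3_eq0 (a + n.-1)) ?mul0rn ?oppr0 ?scaler0 ?mul0rn //; lia.
  exists (half * ('C(b.-1, n.-2) * b)%:R).
  rewrite (ltnW n2) (@x2x3_eq0 (a + n.-1)); last lia.
  rewrite mul0rn subr0 scalerMnr -scalerA scaler_nat mulrnA.
  by rewrite /z; congr (_ *: (_ * _ ^+ _ * _ ^+ _ *+ _ *+ _)); lia.
exists ((c1 + c2) *+ n`!).
by rewrite -addrA -scalerDl mulrnDl -mulrnA scaler_nat scalerMnl.
Qed.

End TopDegrees.

End UnipotentChain.

(** * Modules spanned by Jordan chains *)

Section JordanChains.
Variables (F : fieldType) (M : lmodType F) (T : {linear M -> M}).
Implicit Types (u w x : M).

Local Notation D := (fun x : M => T x - x).

Lemma iterD_linear k : linear (iter k D).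
Proof.
elim: k => [|k IHk] a x y //=; rewrite IHk linearP scalerBr.
by rewrite opprD addrACA.
Qed.

HB.instance Definition _ k :=
  GRing.isLinear.Build F M M *:%R (iter k D) (iterD_linear k).

(** Binomial expansion of (T - 1)^k. It serves the Frobenius identity below and places chains inside
    cyclic submodules. *)
Lemma iterD_expansion k u :
  iter k D u = \sum_(i < k.+1) (('X - 1) ^+ k : {poly F})`_i *: iter i T u.
Proof.
elim: k => [|k IHk]; first by rewrite big_ord1 expr0 coef1 scale1r.
rewrite iterS IHk linear_sum /= exprS.
under [RHS]eq_bigr do rewrite mulrBl mul1r coefB coefXM scalerBl.
rewrite sumrB; congr (_ - _).
  rewrite [RHS]big_ord_recl /= scale0r add0r; apply: eq_bigr => i _.
  by rewrite linearZ.
rewrite [RHS]big_ord_recr /= nth_default ?scale0r ?addr0 //.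
by rewrite -[1]/(1%:P) size_exp_XsubC.
Qed.

(** In characteristic p, (X - 1)^p = X^p - 1. *)
Lemma iterD_prime p u : p \in [pchar F] -> iter p D u = iter p T u - u.
Proof.
move=> charF; have cP : p \in [pchar {poly F}] by rewrite pchar_poly.
have E : ('X - 1) ^+ p = 'X^p - 1 :> {poly F}.
  rewrite -!(pFrobenius_autE cP) pFrobenius_autB_comm ?pFrobenius_aut1 //.
  exact: mulrC.
have := prime_gt0 (pcharf_prime charF); rewrite iterD_expansion E.
case: p {charF cP E} => // q _.
rewrite big_ord_recr big_ord_recl /= !coefB !coefXn !coef1 eqxx /= subr0 sub0r scale1r scaleN1r.
rewrite big1 => [|i _]; first by rewrite addr0 addrC.
rewrite coefB coefXn coef1 /= subr0.
by rewrite (ltn_eqF (_ : bump 0 i < q.+1)%N) ?scale0r // ltnS ltn_ord.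
Qed.

(** The index is reversed: coordinate 0 carries the end D^(n-1) u of the chain and the last
    coordinate carries u, in agreement with the superdiagonal ones of [jordan_block]. *)
Definition chain_map n u (v : 'cV[F]_n) : M :=
  \sum_(j < n) v j 0 *: iter (n.-1 - j) D u.

Lemma chain_map_is_linear n u : linear (@chain_map n u).
Proof.
move=> a v w; rewrite /chain_map scaler_sumr -big_split; apply: eq_bigr => j _ /=.
by rewrite !mxE scalerDl scalerA.
Qed.

HB.instance Definition _ n u :=
  GRing.isLinear.Build F 'cV[F]_n M *:%R (chain_map u) (@chain_map_is_linear n u).

Lemma chain_map_jordan n u (v : 'cV[F]_n) : iter n D u = 0 ->
  chain_map u (jordan_block F n *m v) = T (chain_map u v).
Proof.
move=> un; rewrite /chain_map linear_sum /=.
under eq_bigr do rewrite mxE scaler_suml.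
rewrite exchange_big; apply: eq_bigr => k _ /=.
under eq_bigr do rewrite mxE mulrC -scalerA scalerDl.
rewrite -scaler_sumr linearZ /=; congr (_ *: _).
rewrite big_split /= (bigD1 k) //= eqxx scale1r big1 ?addr0 => [|i /negbTE->]; last by rewrite scale0r.
rewrite -[RHS](subrKC (iter (n.-1 - k) D u)); congr (_ + _).
rewrite -[RHS]/(iter (n.-1 - k).+1 D u).
(* Index 0 is the end of the chain, where D^n u = 0; any other column k has its off-diagonal one in
   row k - 1, which carries D^(n-k) u. *)
have [k0|k0] := posnP (k : nat).
  rewrite k0 subn0 prednK; last exact: leq_ltn_trans (leq0n k) (ltn_ord k).
  by rewrite un big1 // => i _; rewrite scale0r.
have ltk : (k.-1 < n)%N by apply: leq_ltn_trans (leq_pred k) (ltn_ord k).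
rewrite (bigD1 (Ordinal ltk)) //= prednK // eqxx scale1r big1 => [|i ne]; last first.
  rewrite (_ : _ == _ = false) ?scale0r //.
  by apply: contraNF ne => /eqP E; rewrite -val_eqE /= -E.
rewrite addr0 -[RHS]/(iter (n.-1 - k).+1 D u); congr (iter _ D u); have := ltn_ord k; lia.
Qed.

Lemma chain_map_jordan_exp n u (v : 'cV[F]_n) k : iter n D u = 0 ->
  chain_map u (jordan_block F n ^+ k *m v) = iter k T (chain_map u v).
Proof.
move=> un; elim: k => [|k IHk] /=; first by rewrite expr0 mul1mx.
by rewrite exprS -mulmxE -mulmxA chain_map_jordan // IHk.
Qed.

(* Applying D^N to a relation of length N.+1 isolates the coefficients of index N. *)
Lemma chain_coef_eq0 (I : finType) (n : I -> nat) (u : I -> M) N (c : I -> nat -> F) :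
  (forall i, iter (n i) D (u i) = 0) ->
  (forall a : I -> F, \sum_i a i *: iter (n i).-1 D (u i) = 0 -> forall i, a i = 0) ->
  \sum_(k < N) \sum_i c i k *: (if (k < n i)%N then iter ((n i).-1 - k) D (u i) else 0) = 0 ->
  forall i k, (k < N)%N -> (k < n i)%N -> c i k = 0.
Proof.
move=> un indep; elim: N => // N IHN; rewrite big_ord_recr /= => S0.
have cN i : (N < n i)%N -> c i N = 0.
  pose a i := if (N < n i)%N then c i N else 0.
  suff a0 : forall i, a i = 0 by move=> ltN; rewrite -(a0 i) /a ltN.
  apply: indep; have := congr1 (iter N D) S0; rewrite linear0 linearD /= linear_sum /=.
  rewrite big1 ?add0r => [E|k _]; last first.
    rewrite linear_sum big1 //= => j _; rewrite linearZ /=; case: ifP => ltk; last by rewrite linear0 scaler0.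
    rewrite -iterD (_ : N + _ = (N - k.+1) + n j)%N; last by have := ltn_ord k; lia.
    by rewrite iterD un linear0 scaler0.
  rewrite -[RHS]E linear_sum; apply: eq_bigr => j _ /=; rewrite linearZ /a /=.
  case: ifP => ltN; last by rewrite linear0 scale0r scaler0.
  by rewrite -iterD subnKC //; lia.
move=> i k; rewrite ltnS leq_eqVlt => /orP[/eqP->|ltk]; first exact: cN.
apply: IHN => //; rewrite -[RHS]S0 [X in _ = _ + X]big1 ?addr0 // => j _.
by case: ifP => [/cN->|_]; rewrite ?scale0r ?scaler0.
Qed.

(** A dimension count: the square matrix expressing psi through b has independent rows, hence is
    invertible. *)
Lemma span_of_free N (b psi : 'I_N -> M) :
  (forall i, exists r : 'rV[F]_N, psi i = \sum_j r 0 j *: b j) ->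
  (forall c : 'rV[F]_N, \sum_i c 0 i *: psi i = 0 -> c = 0) ->
  forall v : 'rV[F]_N, exists c : 'rV[F]_N, \sum_j v 0 j *: b j = \sum_i c 0 i *: psi i.
Proof.
move=> sp free v.
have [r Er] := boolp.choice sp.
pose R : 'M[F]_N := \matrix_(i, j) r i 0 j.
have E (c : 'rV[F]_N) : \sum_i c 0 i *: psi i = \sum_j (c *m R) 0 j *: b j.
  under eq_bigr do rewrite Er scaler_sumr.
  rewrite exchange_big; apply: eq_bigr => j _ /=.
  by rewrite mxE scaler_suml; apply: eq_bigr => i _; rewrite mxE scalerA.
have Ru : R \in unitmx.
  rewrite -row_free_unit; apply/inj_row_free => c cR; apply: free.
  by rewrite E cR big1 // => j _; rewrite mxE scale0r.
by exists (v *m invmx R); rewrite E -mulmxA mulVmx // mulmx1.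
Qed.

End JordanChains.

(** * Cyclic submodules generated by a chain *)

Section CyclicModules.
Variables (F : fieldType) (p : nat) (M : lmodType F) (T : {linear M -> M}).
Variable act : 'Z_p -> M -> M.
Hypothesis (p_gt1 : (1 < p)%N) (actE : forall g x, act g x = iter g T x).
Implicit Types (u w x : M).

Local Notation D := (fun x : M => T x - x).

Lemma chain_map_act n u g (v : 'cV[F]_n) : iter n D u = 0 ->
  chain_map T u (V_act F p n g v) = act g (chain_map T u v).
Proof. by move=> un; rewrite actE -chain_map_jordan_exp. Qed.

Lemma cyclic_submodule_sum k (c : nat -> F) u : (k <= p)%N ->
  cyclic_submodule act u (\sum_(i < k) c i *: iter i T u).
Proof.
move=> lekp; exists (fun g : 'Z_p => if (g < k)%N then c g else 0).
have lek : (k <= (Zp_trunc p).+2)%N by rewrite Zp_cast.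
rewrite (big_ord_widen _ (fun i => c i *: iter i T u) lek) big_mkcond /=.
by apply: eq_bigr => i _; rewrite actE; case: ifP; rewrite ?scale0r.
Qed.

Lemma cyclic_submoduleD u x y : cyclic_submodule act u x ->
  cyclic_submodule act u y -> cyclic_submodule act u (x + y).
Proof.
case=> a -> [b ->]; exists (fun g => a g + b g).
by rewrite -big_split; apply: eq_bigr => g _; rewrite scalerDl.
Qed.

Lemma cyclic_submoduleZ u a x : cyclic_submodule act u x -> cyclic_submodule act u (a *: x).
Proof.
case=> b ->; exists (fun g => a * b g).
by rewrite scaler_sumr; apply: eq_bigr => g _; rewrite scalerA.
Qed.

(** The generator u is the image of the last basis vector, and [chain_map] is equivariant.
    Conversely each D^i u with i < n is a combination of the T^j u with j < n, and n <= p makes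
    these translates of u by distinct group elements. *)
Lemma cyclic_submodule_chain n u x : (0 < n <= p)%N -> iter n D u = 0 ->
  cyclic_submodule act u x <-> exists v : 'cV[F]_n, x = chain_map T u v.
Proof.
case/andP=> n0 lenp un; split=> [[a ->]|[v ->]].
  have lt : (n.-1 < n)%N by rewrite prednK.
  pose e : 'cV[F]_n := delta_mx (Ordinal lt) 0.
  have eu : chain_map T u e = u.
    rewrite /chain_map (bigD1 (Ordinal lt)) //= mxE !eqxx subnn scale1r big1 ?addr0 // => j ne.
    by rewrite mxE (negbTE ne) scale0r.
  exists (\sum_(g : 'Z_p) a g *: V_act F p n g e); rewrite linear_sum; apply: eq_bigr => g _.
  by rewrite linearZ /= chain_map_act // eu.
rewrite /chain_map; elim/big_ind: _ => [|x1 x2|j _].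
- exists (fun=> 0); rewrite big1 // => g _; exact: scale0r.
- exact: cyclic_submoduleD.
apply: cyclic_submoduleZ; rewrite iterD_expansion.
by apply: (cyclic_submodule_sum (fun i => (('X - 1) ^+ (n.-1 - j))`_i)); have := ltn_ord j; lia.
Qed.

Lemma chain_map_inj n u : iter n D u = 0 -> (n != 0)%N -> iter n.-1 D u != 0 ->
  injective (chain_map T (n := n) u).
Proof.
move=> un n0 un1; apply: raddf_inj => v v0; apply/colP => j; rewrite mxE.
(* A family of chains indexed by [unit] is a single chain; [insub] extends its coordinates by zero
   beyond n. *)
have := @chain_coef_eq0 _ _ T unit (fun=> n) (fun=> u) n
   (fun _ k => if insub k is Some i then v i 0 else 0).
move=> /(_ (fun=> un)) H; rewrite -[LHS](_ : (if insub (j : nat) is Some i then v i 0 else 0) = _).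
  apply: (H _ _ tt j) => //.
    move=> a; rewrite (big_pred1 tt); last by case.
    by move/eqP; rewrite scaler_eq0 (negbTE un1) orbF => /eqP a0 [].
  rewrite -[RHS]v0; apply: eq_bigr => k _; rewrite (big_pred1 tt); last by case.
  by rewrite ltn_ord valK.
by rewrite valK.
Qed.

Lemma cyclic_submodule_iso n u : (0 < n <= p)%N -> iter n D u = 0 -> iter n.-1 D u != 0 ->
  submodule_iso act (cyclic_submodule act u) (V_act F p n).
Proof.
move=> np un un1; have /andP[n0 _] := np; exists (chain_map T u); split.
- by apply: chain_map_inj => //; rewrite -lt0n.
- by move=> g v; apply: chain_map_act.
- by move=> x; apply: cyclic_submodule_chain.
Qed.

End CyclicModules.

(** * Modules filled by one or two Jordan chains *)

Section TwoChains.
Variables (F : fieldType) (p : nat) (M : lmodType F) (T : {linear M -> M}).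
Variable act : 'Z_p -> M -> M.
Hypothesis (p_gt1 : (1 < p)%N) (actE : forall g x, act g x = iter g T x).
Variable W : M -> Prop.
Hypotheses (W0 : W 0) (WD : forall a x y, W x -> W y -> W (a *: x + y)).
Hypothesis WT : forall x, W x -> W (T x).

Local Notation D := (fun x : M => T x - x).

Lemma submodule_iterD k u : W u -> W (iter k D u).
Proof.
move=> Wu; elim: k => //= k IHk; rewrite -scaleN1r addrC; apply: WD => //.
exact: WT.
Qed.

Lemma submodule_chain n u (v : 'cV[F]_n) : W u -> W (chain_map T u v).
Proof.
move=> Wu; rewrite /chain_map; elim/big_rec: _ => // j x _ Wx.
by apply: WD => //; apply: submodule_iterD.
Qed.

Lemma fixed_pointsE x : fixed_points act x <-> T x = x.
Proof.
split=> [fx | Tx g]; last by rewrite actE; elim: (g : nat) => //= k ->.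
by have := fx (Zp_gen p); rewrite actE.
Qed.

(** A chain of length n with nonzero end is free, and W has n spanning vectors, so the chain is a
    basis of W. *)
Lemma one_chain_module n u (e : 'I_n -> M) :
  (0 < n <= p)%N -> W u -> iter n D u = 0 -> iter n.-1 D u != 0 ->
  (forall x, W x -> exists v : 'rV[F]_n, x = \sum_j v 0 j *: e j) ->
  submodule_iso act W (V_act F p n).
Proof.
move=> np Wu un un1 W_span; have inj := chain_map_inj un _ un1; exists (chain_map T u).
split=> [|g v|x]; first by apply: inj; lia.
  exact: chain_map_act.
split=> [Wx|[v ->]]; last exact: submodule_chain.
have [r ->] := W_span x Wx.
have E (c : 'rV[F]_n) : \sum_j c 0 j *: iter (n.-1 - j) D u = chain_map T u c^T.
  by apply: eq_bigr => j _; rewrite mxE.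
have [||c ->] := @span_of_free _ _ _ e (fun j => iter (n.-1 - j) D u) _ _ r.
- by move=> i; apply: W_span; apply: submodule_iterD.
- move=> c; rewrite E => c0; rewrite -[c]trmxK (_ : c^T = 0) ?trmx0 //.
  by apply: inj; [lia | rewrite c0 linear0].
by exists c^T.
Qed.

Variables (n m : nat) (u w s1 s2 : M) (a b c d : F).
Hypotheses (n_p : (0 < n <= p)%N) (m_p : (0 < m <= p)%N) (Wu : W u) (Ww : W w).
Hypotheses (Dnu : iter n D u = 0) (Dmw : iter m D w = 0).
Hypothesis s_free : forall x y : F, x *: s1 + y *: s2 = 0 -> x = 0 /\ y = 0.
Hypotheses (socu : iter n.-1 D u = a *: s1 + b *: s2).
Hypotheses (socw : iter m.-1 D w = c *: s1 + d *: s2).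
Hypothesis det_neq0 : a * d - b * c != 0.
Variable e : 'I_(n + m) -> M.
Hypothesis W_span : forall x, W x -> exists v : 'rV[F]_(n + m), x = \sum_j v 0 j *: e j.

(** Cramer's rule for the matrix with rows (a, b) and (c, d) that expresses the ends of the two
    chains through s1 and s2. *)
Let soc_free (x y : F) :
  x *: iter n.-1 D u + y *: iter m.-1 D w = 0 -> x = 0 /\ y = 0.
Proof.
rewrite socu socw !scalerDr !scalerA addrACA -!scalerDl => /s_free[E1 E2].
have X : x * (a * d - b * c) = (x * a + y * c) * d - (x * b + y * d) * c by ring.
have Y : y * (a * d - b * c) = (x * b + y * d) * a - (x * a + y * c) * b by ring.
rewrite E1 E2 !mul0r subrr in X Y.
by move/eqP: X; move/eqP: Y; rewrite !mulf_eq0 (negbTE det_neq0) !orbF => /eqP-> /eqP->.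
Qed.

Let pair_map (v : 'cV[F]_n * 'cV[F]_m) : M := chain_map T u v.1 + chain_map T w v.2.

Let pair_map_is_linear : linear pair_map.
Proof. by move=> k v v'; rewrite /pair_map !linearP /= scalerDr addrACA. Qed.

Let pair_map_eq0 v1 v2 : pair_map (v1, v2) = 0 -> v1 = 0 /\ v2 = 0.
Proof.
(* Both coordinate vectors are extended by zero to the common length [maxn n m], so that the
   independence lemma applies with the two chains indexed by [bool]. *)
pose C (i : bool) k := if i then (if insub k is Some j then v1 j 0 else 0)
  else (if insub k is Some j then v2 j 0 else 0).
move=> E.
have C0 i k : (k < maxn n m)%N -> (k < if i then n else m)%N -> C i k = 0.
  move: i k; apply: (@chain_coef_eq0 _ _ T bool (fun i : bool => if i then n else m)
    (fun i : bool => if i then u else w) (maxn n m) C).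
  - by case.
  - by move=> x; rewrite big_bool /= => /soc_free[x0 y0] [].
  rewrite -[RHS]E /pair_map /chain_map /=.
  have En (l r : nat) (V : 'cV[F]_l) z : (l <= r)%N ->
    \sum_(k < r) (if insub (k : nat) is Some j then V j 0 else 0) *:
      (if (k < l)%N then iter (l.-1 - k) D z else 0) =
    \sum_(j < l) V j 0 *: iter (l.-1 - j) D z.
    move=> le; pose G k := (if insub k is Some j then V j 0 else 0) *: iter (l.-1 - k) D z.
    rewrite [RHS](eq_bigr (fun j : 'I_l => G (val j))) => [|j _]; last by rewrite /G valK.
    rewrite (big_ord_widen r G le) [RHS]big_mkcond; apply: eq_bigr => k _ /=.
    by case: ifP => //; rewrite scaler0.
  rewrite -(En n (maxn n m)) ?leq_maxl // -(En m (maxn n m)) ?leq_maxr // -big_split.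
  by apply: eq_bigr => k _; rewrite big_bool.
split; apply/colP => j; rewrite mxE.
  have := C0 true j; rewrite /C /= valK => -> //.
  by rewrite leq_max ltn_ord.
have := C0 false j; rewrite /C /= valK => -> //.
by rewrite leq_max ltn_ord orbT.
Qed.

(** The n + m chain vectors are free by [pair_map_eq0] and lie in a space with n + m spanning
    vectors. *)
Let pair_map_surj x : W x -> exists v, x = pair_map v.
Proof.
move=> Wx; have [r ->] := W_span Wx.
pose psi (i : 'I_(n + m)) := match split i with
  | inl j => iter (n.-1 - j) D u | inr j => iter (m.-1 - j) D w end.
have E (v : 'rV[F]_(n + m)) :
    \sum_i v 0 i *: psi i = pair_map ((lsubmx v)^T, (rsubmx v)^T).
  rewrite big_split_ord; congr (_ + _); apply: eq_bigr => j _; rewrite !mxE; congr (_ *: _).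
    by rewrite /psi (unsplitK (inl j)).
  by rewrite /psi (unsplitK (inr j)).
have [||v ->] := @span_of_free _ _ _ e psi _ _ r.
- by move=> i; apply: W_span; rewrite /psi; case: split => j; apply: submodule_iterD.
- move=> v; rewrite E => /pair_map_eq0[l0 r0].
  by rewrite -[v]hsubmxK -[lsubmx v]trmxK -[rsubmx v]trmxK l0 r0 !trmx0 row_mx0.
by exists ((lsubmx v)^T, (rsubmx v)^T); rewrite E.
Qed.

Let W_pair v : W (pair_map v).
Proof.
rewrite /pair_map -[chain_map T u _]scale1r; apply: WD; exact: submodule_chain.
Qed.

(** Everything follows from the bijectivity of [pair_map] onto W. The fixed points are the images of
    the fixed vectors of the two Jordan blocks, that is, the span of the two chain ends. *)
Lemma two_chain_module :
  [/\ direct_sum W (cyclic_submodule act u) (cyclic_submodule act w),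
      submodule_iso act (cyclic_submodule act u) (V_act F p n),
      submodule_iso act (cyclic_submodule act w) (V_act F p m),
      submodule_iso act W (sum_act (V_act F p n) (V_act F p m))
    & forall x, (W x /\ fixed_points act x) <-> span2 s1 s2 x].
Proof.
have cu := cyclic_submodule_chain p_gt1 actE _ n_p Dnu.
have cw := cyclic_submodule_chain p_gt1 actE _ m_p Dmw.
have [n0 m0] : (0 < n)%N /\ (0 < m)%N by lia.
split.
- split=> [x|x /cu[v1 ->] /cw[v2 E]].
    split=> [/pair_map_surj[v ->]|[x1 [x2 [/cu[v1 ->] /cw[v2 ->] ->]]]]; last exact: (W_pair (v1, v2)).
    by exists (chain_map T u v.1), (chain_map T w v.2); split=> //; [apply/cu; eexists | apply/cw; eexists].
  (* A common element of the two submodules gives a pair (v1, -v2) in the kernel. *)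
  have [|-> _] := @pair_map_eq0 v1 (- v2); last by rewrite linear0.
  by rewrite /pair_map linearN /= E subrr.
- apply: cyclic_submodule_iso => //; apply/eqP => E.
  have [|/eqP] := @soc_free 1 0; first by rewrite E scaler0 scale0r addr0.
  by rewrite oner_eq0.
- apply: cyclic_submodule_iso => //; apply/eqP => E.
  have [|_ /eqP] := @soc_free 0 1; first by rewrite E scaler0 scale0r addr0.
  by rewrite oner_eq0.
- pose f : {linear ('cV[F]_n * 'cV[F]_m)%type -> M} := HB.pack pair_map
    (GRing.isLinear.Build _ _ _ _ _ pair_map_is_linear).
  exists f; split.
  + apply: raddf_inj => -[v1 v2] /pair_map_eq0[-> ->] //.
  + move=> g v; rewrite /= /pair_map /= !(chain_map_act actE) //.
    by rewrite !actE; elim: (g : nat) => //= k <-; rewrite linearD.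
  + by move=> x; split=> [/pair_map_surj //|[v ->]]; apply: W_pair.
move=> x; rewrite fixed_pointsE; split=> [[/pair_map_surj[v ->] Tv]|[k [l ->]]].
  (* A vector fixed by the Jordan block has only its coordinate 0, which [chain_map] sends to the
     end of the chain. *)
  have Jv l (z : 'cV[F]_l) (l0 : (0 < l)%N) y : jordan_block F l *m z = z ->
      chain_map T y z = z (Ordinal l0) 0 *: iter l.-1 D y.
    move=> Jz; rewrite /chain_map (bigD1 (Ordinal l0)) //= subn0 big1 ?addr0 // => k ne.
    have k0 : (0 < k)%N by rewrite lt0n; apply: contraNneq ne => E; apply/eqP/val_inj.
    have ltk : (k.-1 < l)%N by have := ltn_ord k; lia.
    have := congr1 (fun V : 'cV_l => V (Ordinal ltk) 0) Jz; rewrite !mxE.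
    under eq_bigr do rewrite mxE mulrDl.
    rewrite big_split /= (bigD1 (Ordinal ltk)) //= eqxx mul1r big1 ?addr0 => [|i ne']; last first.
      by rewrite eq_sym (negbTE ne') mul0r.
    rewrite (bigD1 k) //= prednK // eqxx mul1r big1 ?addr0 => [|i ne']; last first.
      by rewrite (_ : _ == _ = false) ?mul0r //; apply: contraNF ne' => /eqP E; apply/eqP/val_inj.
    by move/eqP; rewrite addrC -[X in _ == X]add0r (inj_eq (addIr _)) => /eqP->; rewrite scale0r.
  have [E1 E2] : jordan_block F n *m v.1 - v.1 = 0 /\ jordan_block F m *m v.2 - v.2 = 0.
    apply: pair_map_eq0; rewrite /pair_map !linearB /= !chain_map_jordan //.
    by move/eqP: Tv; rewrite -subr_eq0 /pair_map linearD opprD addrACA => /eqP.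
  exists (v.1 (Ordinal n0) 0 * a + v.2 (Ordinal m0) 0 * c).
  exists (v.1 (Ordinal n0) 0 * b + v.2 (Ordinal m0) 0 * d).
  rewrite /pair_map (Jv _ _ n0) ?(Jv _ _ m0); try exact/subr0_eq.
  by rewrite socu socw !scalerDr !scalerA addrACA -!scalerDl.
(* Inverting the two-by-two matrix writes s1 and s2 through the chain ends. *)
pose det := a * d - b * c.
have -> : k *: s1 + l *: s2 = ((k * d - l * c) / det) *: iter n.-1 D u
    + ((l * a - k * b) / det) *: iter m.-1 D w.
  rewrite socu socw !scalerDr !scalerA addrACA -!scalerDl.
  by congr (_ *: _ + _ *: _); rewrite /det; field.
split; last first.
  have fixD y j : (0 < j)%N -> iter j D y = 0 -> T (iter j.-1 D y) = iter j.-1 D y.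
    by move=> j0 yj; apply/eqP; rewrite -subr_eq0 -yj -{3}(prednK j0).
  by rewrite linearD !linearZ /= !fixD.
rewrite -[X in W (_ + X)]addr0; do 2![apply: WD => //; first exact: submodule_iterD].
Qed.

End TwoChains.

(** * Invariants in coordinates adapted to the Jordan basis *)

(** Suited to properties compatible with sums and products, such as equalities of ring morphisms or
    the chain rule below. *)
Lemma mpoly_ring_ind (R : comNzRingType) n (P : {mpoly R[n]} -> Prop) :
  (forall c, P c%:MP) -> (forall i, P 'X_i) ->
  (forall f g, P f -> P g -> P (f + g)) -> (forall f g, P f -> P g -> P (f * g)) ->
  forall f, P f.
Proof.
move=> PC PX PD PM; elim/mpolyind => [|c m f _ _ Pf]; first by rewrite -mpolyC0.
apply: (PD _ _ _ Pf); rewrite -mul_mpolyC; apply: (PM) => //; rewrite mpolyXE_id.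
elim/big_ind: _ => [||i _]; [by rewrite -mpolyC1 | exact: PM |].
by elim: (m i) => [|k IHk]; [rewrite expr0 -mpolyC1 | rewrite exprS; apply: (PM)].
Qed.

Section LinearChange.
Variables (F : fieldType) (n : nat).
Implicit Types (f g : {mpoly F[n]}) (M N : 'M[F]_n).

Definition lsub M f := f \mPo [tuple linear_form (row i M) | i < n].

Lemma lsubC M c : lsub M c%:MP = c%:MP. Proof. exact: comp_mpolyC. Qed.

Lemma lsubD M : {morph lsub M : f g / f + g}. Proof. exact: raddfD. Qed.

Lemma lsubM M : {morph lsub M : f g / f * g}. Proof. exact: rmorphM. Qed.

Lemma lsubX M i : lsub M 'X_i = linear_form (row i M).
Proof. by rewrite /lsub comp_mpolyXU -tnth_nth tnth_mktuple. Qed.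

Lemma lsub_linear_form M (u : 'rV[F]_n) : lsub M (linear_form u) = linear_form (u *m M).
Proof.
rewrite /lsub /linear_form raddf_sum /=.
under eq_bigr => i _ do rewrite comp_mpolyZ -[_ \mPo _]/(lsub M _) lsubX /linear_form scaler_sumr.
rewrite exchange_big; apply: eq_bigr => j _ /=; rewrite mxE scaler_suml.
by apply: eq_bigr => i _; rewrite mxE scalerA.
Qed.

Lemma lsub_comp M N f : lsub M (lsub N f) = lsub (N *m M) f.
Proof.
elim/mpoly_ring_ind: f => [c|i|f g IHf IHg|f g IHf IHg].
- by rewrite !lsubC.
- by rewrite !lsubX lsub_linear_form row_mul.
- by rewrite !lsubD IHf IHg.
- by rewrite !lsubM IHf IHg.
Qed.

Lemma linear_form_delta (i : 'I_n) : linear_form (delta_mx 0 i) = 'X_i :> {mpoly F[n]}.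
Proof.
rewrite /linear_form (bigD1 i) //= mxE !eqxx scale1r big1 ?addr0 // => j ne.
by rewrite mxE eqxx (negbTE ne) scale0r.
Qed.

Lemma lsub1 f : lsub 1%:M f = f.
Proof.
rewrite /lsub -[RHS]comp_mpoly_id; congr (f \mPo _).
by apply: eq_mktuple => i; rewrite row1 linear_form_delta.
Qed.

Lemma linear_form_homog (u : 'rV[F]_n) : linear_form u \is 1.-homog.
Proof. by apply: rpred_sum => i _; apply: rpredZ; rewrite dhomogX /= mdeg1. Qed.

Lemma lsub_homog M d f : f \is d.-homog -> lsub M f \is d.-homog.
Proof.
move=> fd; rewrite /lsub comp_mpolyE big_seq; apply: rpred_sum => m mf.
apply: rpredZ; rewrite -(dhomog_mf fd mf) /= mdegE.
elim/big_rec2: _ => [|i k g _ IH]; first exact: dhomog1.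
rewrite tnth_mktuple; apply: dhomogM => //.
by have := dhomogMn (m i) (linear_form_homog (row i M)); rewrite mul1n.
Qed.

Lemma poly_act_lsub (gT : finGroupType) (rho : gT -> 'M[F]_n) (x : gT) f :
  poly_act rho x f = lsub (rho x^-1%g) f.
Proof.
rewrite /poly_act /lsub; congr (f \mPo _).
by apply: eq_mktuple => i; rewrite /dual_act rowE.
Qed.

End LinearChange.

(** * Values and directional derivatives under the unipotent substitution *)

Section UnipotentEvaluation.
Variables (F : fieldType) (A : comNzRingType) (iota : {rmorphism F -> A}) (n : nat).
Implicit Types (f g : {mpoly F[n.+1]}) (h w : 'I_n.+1 -> A).

(** One formula for the generator on the variables, on points and on tangent vectors, hence the
    arbitrary additive group V. *)
Definition shift_sum (V : zmodType) (h : 'I_n.+1 -> V) : 'I_n.+1 -> V :=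
  fun i => h i + (if i : nat is k.+1 then h (inord k) else 0).

Definition unip_subst f := f \mPo [tuple shift_sum (fun j => 'X_j) i | i < n.+1].

Lemma mmap_unip h f : mmap iota h (unip_subst f) = mmap iota (shift_sum h) f.
Proof.
rewrite /unip_subst; elim/mpoly_ring_ind: f => [c|i|f g IHf IHg|f g IHf IHg].
- by rewrite comp_mpolyC !mmapC.
- rewrite comp_mpolyXU -tnth_nth tnth_mktuple mmapX mmap1U /shift_sum raddfD /= mmapX mmap1U.
  by case: (i : nat) => [|k]; rewrite ?raddf0 // mmapX mmap1U.
- by rewrite !raddfD /= IHf IHg.
- by rewrite !rmorphM /= IHf IHg.
Qed.

Definition dir_deriv h w f := \sum_i w i * mmap iota h f^`M(i).

Lemma dir_derivD h w f g : dir_deriv h w (f + g) = dir_deriv h w f + dir_deriv h w g.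
Proof.
by rewrite /dir_deriv -big_split; apply: eq_bigr => i _; rewrite mderivD raddfD mulrDr.
Qed.

Lemma dir_derivM h w f g : dir_deriv h w (f * g) =
  dir_deriv h w f * mmap iota h g + mmap iota h f * dir_deriv h w g.
Proof.
rewrite /dir_deriv mulr_suml mulr_sumr -big_split; apply: eq_bigr => i _ /=.
by rewrite mderivM raddfD /= !rmorphM /= mulrDr mulrA mulrCA.
Qed.

Lemma dir_derivX h w i : dir_deriv h w 'X_i = w i.
Proof.
rewrite /dir_deriv (bigD1 i) //= mderivX mnm1E eqxx scale1r.
rewrite [X in 'X_[X]](_ : _ = 0%MM) ?mmapX ?mmap11 ?mulr1; last by apply/mnmP => j; rewrite mnmBE subnn mnm0E.
rewrite big1 ?addr0 // => j ne; rewrite mderivX mnm1E eq_sym (negbTE ne).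
by rewrite scale0r raddf0 mulr0.
Qed.

(** The chain rule: the substitution is linear, so the tangent vector is moved by the same map as
    the point. *)
Lemma dir_deriv_unip h w f :
  dir_deriv h w (unip_subst f) = dir_deriv (shift_sum h) (shift_sum w) f.
Proof.
rewrite /unip_subst; elim/mpoly_ring_ind: f => [c|i|f g IHf IHg|f g IHf IHg].
- by rewrite comp_mpolyC /dir_deriv !big1 // => i _; rewrite mderivC raddf0 mulr0.
- rewrite comp_mpolyXU -tnth_nth tnth_mktuple dir_derivX /shift_sum dir_derivD dir_derivX.
  case: (i : nat) => [|k]; rewrite ?dir_derivX // /dir_deriv big1 // => j _.
  by rewrite linear0 raddf0 mulr0.
- by rewrite raddfD /= !dir_derivD IHf IHg.
- by rewrite rmorphM /= !dir_derivM IHf IHg -/(unip_subst f) -/(unip_subst g) !mmap_unip.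
Qed.

End UnipotentEvaluation.

(** * Polynomials with period 1 in characteristic p *)

Section PrimeCharPoly.
Variables (F : fieldType) (p : nat).
Hypothesis charF : p \in [pchar F].
Implicit Types (P Q : {poly F}).

Let p_pr : prime p := pcharf_prime charF.

Lemma natr_neq0 k : (0 < k < p)%N -> k%:R != 0 :> F.
Proof.
case/andP=> k0 ltk; rewrite -(dvdn_pcharf charF); apply: contraTN ltk => /dvdn_leq.
by rewrite -leqNgt; apply.
Qed.

Lemma natrD_neq0 k : (p < k < 2 * p)%N -> k%:R != 0 :> F.
Proof.
move=> /andP[k0 ltk]; rewrite -(subnK (ltnW k0)) natrD (pcharf0 charF) addr0.
by apply: natr_neq0; lia.
Qed.

Lemma fact_neq0 n : (n < p)%N -> n`!%:R != 0 :> F.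
Proof.
elim: n => [|n IHn] ltn; first by rewrite oner_neq0.
by rewrite factS natrM mulf_neq0 //; [apply: natr_neq0; lia | apply: IHn; lia].
Qed.

Lemma bin_neq0 b n : (n <= b < p)%N -> 'C(b, n)%:R != 0 :> F.
Proof.
case/andP=> len ltb; have := fact_neq0 ltb.
by rewrite -(bin_fact len) natrM mulf_eq0 negb_or => /andP[].
Qed.

Lemma poly_vanish_prime_subfield P :
  (size P <= p)%N -> (forall k : nat, P.[k%:R] = 0) -> P = 0.
Proof.
move=> leP P0; pose rs : seq F := [seq k%:R | k <- iota 0 p].
apply: (roots_geq_poly_eq0 (rs := rs)); last by rewrite size_map size_iota.
- by apply/allP => x /mapP[k _ ->]; rewrite rootE P0.
rewrite map_inj_in_uniq ?iota_uniq // => i j; rewrite !mem_iota !add0n /=.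
wlog leij : i j / (i <= j)%N => [H|].
  by case/orP: (leq_total i j) => le li lj E; [apply: H | apply/esym/H].
move=> _ ltj /eqP; rewrite eq_sym -subr_eq0 -natrB // -(dvdn_pcharf charF) => dv.
have [d0|d0] := posnP (j - i); first by lia.
by have := dvdn_leq d0 dv; lia.
Qed.

(** A periodic polynomial of degree j has j times its leading coefficient equal to zero; so degrees
    invertible in F are excluded one at a time, from the top down. *)
Lemma size_periodic P m n : fdiff P = 0 -> (size P <= n.+1)%N ->
  (forall j, (m < j <= n)%N -> j%:R != 0 :> F) -> (size P <= m.+1)%N.
Proof.
move=> dP; elim: n => [|n IHn] leP nz; first exact: leq_trans leP _.
have [lt|le] := ltnP m n.+1; last by apply: leq_trans leP _; rewrite ltnS.
apply: IHn => [|j /andP[lj ljn]]; last by apply: nz; rewrite lj ltnW.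
apply/leq_sizeP => j; rewrite leq_eqVlt => /orP[/eqP<-|ltj].
  have := coef_fdiff leP; rewrite dP coef0 => /esym/eqP.
  by rewrite -mulr_natr mulf_eq0 (negbTE (nz _ _)) ?orbF ?lt //= => /eqP.
by rewrite nth_default // (leq_trans leP).
Qed.

Lemma periodic_const P : fdiff P = 0 -> (size P <= p)%N -> (size P <= 1)%N.
Proof.
move=> dP leP; apply: (size_periodic (n := p.-1)) => //.
  by rewrite prednK // prime_gt0.
move=> j /andP[j0 lej]; apply: natr_neq0; have := prime_gt0 p_pr; lia.
Qed.

Lemma fdiffB P Q : fdiff (P - Q) = fdiff P - fdiff Q.
Proof. by rewrite /fdiff raddfB /=; ring. Qed.

Lemma fdiffZ c P : fdiff (c *: P) = c *: fdiff P.
Proof. by rewrite /fdiff comp_polyZ scalerBr. Qed.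

Lemma XD1_frob : ('X + 1) ^+ p = 'X^p + 1 :> {poly F}.
Proof.
have cP : p \in [pchar {poly F}] by rewrite pchar_poly.
by rewrite -(pFrobenius_autE cP) pFrobenius_autD_comm ?pFrobenius_aut1 ?pFrobenius_autE //; exact: mulrC.
Qed.

(* Such a polynomial is a linear combination of 1 and 'X^p - 'X. *)
Lemma periodic_coef P : fdiff P = 0 -> (size P <= 2 * p)%N ->
  forall j, (1 < j < p)%N -> P`_j = 0.
Proof.
move=> dP leP j jp; have p0 := prime_gt0 p_pr.
have leP1 : (size P <= p.+1)%N.
  apply: (size_periodic (n := (2 * p).-1)) => //; first by lia.
  by move=> i ip; apply: natrD_neq0; lia.
pose Q := P - P`_p *: ('X^p - 'X).
have dQ : fdiff Q = 0.
  rewrite fdiffB dP fdiffZ /fdiff comp_polyB comp_polyX comp_Xn_poly XD1_frob.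
  by rewrite (_ : _ - _ - _ = 0) ?scaler0 ?subr0 //; ring.
have leQ : (size Q <= p)%N.
  apply/leq_sizeP => i lei; rewrite coefB coefZ coefB coefXn coefX.
  case: (ltngtP p i) lei => // [lti|<-] _.
    by rewrite nth_default ?(leq_trans leP1) // (gtn_eqF (ltn_trans (prime_gt1 p_pr) lti)) subrr mulr0 subr0.
  by rewrite (gtn_eqF (prime_gt1 p_pr)) subr0 mulr1 subrr.
have Qj : Q`_j = 0 by rewrite nth_default // (leq_trans (periodic_const dQ leQ)) //; lia.
have : P = Q + P`_p *: ('X^p - 'X) by rewrite subrK.
move=> ->; rewrite coefD Qj coefZ coefB coefXn coefX.
case/andP: jp => j1 ltjp.
by rewrite (ltn_eqF ltjp) (gtn_eqF j1) subrr mulr0 addr0.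
Qed.

End PrimeCharPoly.

(** * Polynomials in four variables and their restrictions to lines *)

Definition vec4 (V : zmodType) (a b c d : V) : 'I_4 -> V := fun i => nth 0 [:: a; b; c; d] i.

Definition mnm4 (a b c d : nat) : 'X_{1..4} := [multinom nth 0%N [:: a; b; c; d] i | i < 4].

Lemma shift_sum_vec4 (V : zmodType) (a b c d : V) :
  shift_sum (vec4 a b c d) = vec4 a (b + a) (c + b) (d + c).
Proof.
apply: boolp.funext => -[[|[|[|[|i]]]] lti] //; rewrite /shift_sum /vec4 /= ?addr0 //;
  by rewrite inordK.
Qed.

Lemma mnm4_ind (P : 'X_{1..4} -> Prop) : (forall a b c d, P (mnm4 a b c d)) -> forall m, P m.
Proof.
move=> H m; pose v k := m (inord k).
rewrite (_ : m = mnm4 (v 0) (v 1) (v 2) (v 3))%N //; apply/mnmP => -[k ltk].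
rewrite mnmE /v; move: (k) (ltk) => [|[|[|[|i]]]] // lt; congr (m _); apply: val_inj;
  by rewrite /= inordK.
Qed.

Lemma mdeg_mnm4 a b c d : mdeg (mnm4 a b c d) = (a + b + c + d)%N.
Proof. by rewrite mdegE !big_ord_recl big_ord0 !mnmE /= !addnA addn0. Qed.

Lemma mnm4_eq a b c d a' b' c' d' : (mnm4 a b c d == mnm4 a' b' c' d') =
  [&& a == a', b == b', c == c' & d == d'].
Proof.
apply/eqP/and4P => [E|[/eqP-> /eqP-> /eqP-> /eqP->] //].
have H (k : nat) (ltk : (k < 4)%N) : nth 0%N [:: a; b; c; d] k = nth 0%N [:: a'; b'; c'; d'] k.
  by have := congr1 (fun m : 'X_{1..4} => m (Ordinal ltk)) E; rewrite !mnmE.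
by split; apply/eqP; [apply: (H 0%N) | apply: (H 1%N) | apply: (H 2%N) | apply: (H 3%N)].
Qed.

Lemma mmap1_vec4 (A : comNzRingType) (x y z t : A) a b c d :
  mmap1 (vec4 x y z t) (mnm4 a b c d) = x ^+ a * y ^+ b * z ^+ c * t ^+ d.
Proof. by rewrite /mmap1 !big_ord_recl big_ord0 !mnmE /= mulr1 !mulrA. Qed.

Section Restrictions.
Variable F : fieldType.
Implicit Types (g : {mpoly F[4]}) (h : 'I_4 -> {poly F}).

(** For the lines below, each monomial restricts to a scalar times a power of the parameter.
    Homogeneity then determines the monomial from that power, so a coefficient of the restriction
    isolates one coefficient of g. *)
Lemma coef_mmap h e g j c m0 : g \is e.-homog ->
  (forall m, mdeg m = e -> (mmap1 h m)`_j = c * (m == m0)%:R) ->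
  (mmap polyC h g)`_j = c * g@_m0.
Proof.
move=> ge H; rewrite /mmap coef_sum [in RHS](mpolyE g) raddf_sum mulr_sumr /=.
rewrite !big_seq; apply: eq_bigr => m mg.
by rewrite coefCM H ?(dhomog_mf ge mg) // mcoeffZ mcoeffX mulrCA.
Qed.

Definition on_line34 g : {poly F} := mmap polyC (vec4 0 0 1 'X) g.
(** The second coordinate is 2 so that the k-th iterate of the generator gives (0, 2, y, 0) the last
    coordinate k y + k(k-1), free of denominators and zero at y = 1 - k. *)
Definition on_line23 g : {poly F} := mmap polyC (vec4 0 2%:R%:P 'X 0) g.

Lemma coef_on_line34 e g j : g \is e.-homog ->
  (on_line34 g)`_j = if (j <= e)%N then g@_(mnm4 0 0 (e - j) j) else 0.
Proof.
move=> ge; rewrite /on_line34 (coef_mmap (c := (j <= e)%N%:R) (m0 := mnm4 0 0 (e - j) j) ge).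
  by case: ifP; rewrite (mul1r, mul0r).
elim/mnm4_ind => a b c d; rewrite mdeg_mnm4 mmap1_vec4 mnm4_eq => E.
rewrite expr1n mulr1; case: a E => [|a] E; last by rewrite exprS !mul0r coef0 /= ?mulr0n mulr0.
case: b E => [|b] E; last by rewrite [0 ^+ b.+1]exprS mul0r mulr0 mul0r coef0 /= ?mulr0n mulr0.
rewrite !expr0 !mul1r coefXn /= -natrM mulnb; congr (_%:R); lia.
Qed.

Lemma coef_on_line23 e g j : g \is e.-homog ->
  (on_line23 g)`_j = if (j <= e)%N then 2%:R ^+ (e - j) * g@_(mnm4 0 (e - j) j 0) else 0.
Proof.
move=> ge; rewrite /on_line23.
rewrite (coef_mmap (c := (j <= e)%N%:R * 2%:R ^+ (e - j)) (m0 := mnm4 0 (e - j) j 0) ge).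
  by case: ifP; rewrite ?mul1r ?mul0r.
elim/mnm4_ind => a b c d; rewrite mdeg_mnm4 mmap1_vec4 mnm4_eq => E.
case: a E => [|a] E; last by rewrite exprS !mul0r coef0 /= ?mulr0n mulr0.
case: d E => [|d] E; last by rewrite [0 ^+ d.+1]exprS mul0r mulr0 coef0 /= !andbF ?mulr0n mulr0.
rewrite !expr0 mul1r mulr1 -polyC_exp coefCM coefXn /= andbT mulrAC -natrM mulnb mulrC.
case: (eqVneq j c) => [->|ne]; last by rewrite !andbF !mul0r.
rewrite -E (_ : _ && _ = true); last lia.
by congr (_ * _ ^+ _); lia.
Qed.

End Restrictions.

(** * Vanishing coefficients of an invariant of positive degree *)

Section InvariantCoefficients.
Variables (F : fieldType) (p : nat).
Hypotheses (charF : p \in [pchar F]) (p_ge5 : (5 <= p)%N).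
Variables (f : {mpoly F[4]}) (d : nat).
Hypotheses (f_homog : f \is d.+1.-homog) (f_inv : unip_subst f = f).

Implicit Types (g : {mpoly F[4]}).

Let i0 : 'I_4 := @Ordinal 4 0 isT.
Let i1 : 'I_4 := @Ordinal 4 1 isT.
Let i2 : 'I_4 := @Ordinal 4 2 isT.
Let i3 : 'I_4 := @Ordinal 4 3 isT.

Lemma mderiv_homog i : f^`M(i) \is d.-homog.
Proof.
apply/dhomogP => m; rewrite mcoeff_msupp mcoeff_mderiv => nz.
have : (m + U_(i))%MM \in msupp f.
  by rewrite mcoeff_msupp; apply: contraNneq nz => ->; rewrite mul0rn.
by move/(dhomog_mf f_homog); rewrite /= mdegD mdeg1 addn1 => -[].
Qed.

Lemma comp_mmap_poly (h : 'I_4 -> {poly F}) g q :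
  mmap polyC h g \Po q = mmap polyC (fun i => h i \Po q) g.
Proof.
elim/mpoly_ring_ind: g => [c|i|g1 g2 IH1 IH2|g1 g2 IH1 IH2].
- by rewrite !mmapC comp_polyC.
- by rewrite !mmapX !mmap1U.
- by rewrite !raddfD /= IH1 IH2.
- by rewrite !rmorphM /= IH1 IH2.
Qed.

Lemma horner_mmap_poly (h : 'I_4 -> {poly F}) g x :
  (mmap polyC h g).[x] = mmap idfun (fun i => (h i).[x]) g.
Proof.
elim/mpoly_ring_ind: g => [c|i|g1 g2 IH1 IH2|g1 g2 IH1 IH2].
- by rewrite !mmapC hornerC.
- by rewrite !mmapX !mmap1U.
- by rewrite !raddfD /= hornerD IH1 IH2.
- by rewrite !rmorphM /= hornerM IH1 IH2.
Qed.

Lemma on_line34_shift g :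
  mmap polyC (vec4 0 0 1 ('X + 1)) g = on_line34 g \Po ('X + 1).
Proof.
rewrite /on_line34 comp_mmap_poly; congr (mmap _ _ g); apply: boolp.funext.
case=> [[|[|[|[|i]]]] lt] //; rewrite /vec4 /=.
- by rewrite comp_poly0.
- by rewrite comp_poly0.
- by rewrite comp_polyC.
- by rewrite comp_polyX.
Qed.

Lemma on_line23_horner g y : (on_line23 g).[y] = mmap idfun (vec4 0 2%:R y 0) g.
Proof.
rewrite /on_line23 horner_mmap_poly; congr (mmap _ _ g); apply: boolp.funext.
by case=> [[|[|[|[|i]]]] lt] //; rewrite /vec4 /= ?hornerC ?hornerX ?horner0.
Qed.

Lemma dir_deriv_vec4 (A : comNzRingType) (iota : {rmorphism F -> A}) h (a b c e : A) :
  dir_deriv iota h (vec4 a b c e) f = a * mmap iota h f^`M(i0) + b * mmap iota h f^`M(i1)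
    + c * mmap iota h f^`M(i2) + e * mmap iota h f^`M(i3).
Proof.
rewrite /dir_deriv !big_ord_recl big_ord0 /vec4 /= addr0 !addrA.
by do ![congr (_ + _)]; congr (_ * mmap _ _ f^`M(_)); apply: val_inj.
Qed.

(** The generator sends (0, 0, 1, t) to (0, 0, 1, t + 1). *)
Lemma fdiff_line34 : fdiff (on_line34 f) = 0.
Proof.
by rewrite /fdiff -on_line34_shift /on_line34 -{2}f_inv mmap_unip shift_sum_vec4 !addr0 subrr.
Qed.

(** The direction (0, 1, 0, 0) at parameter t is carried to (0, 1, 1, 0) at t + 1, so the
    X2-derivative at t equals the sum of the X2- and X3-derivatives at t + 1. *)
Lemma fdiff_line34_deriv :
  fdiff (on_line34 f^`M(i1)) = - (on_line34 f^`M(i2) \Po ('X + 1)).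
Proof.
have E := dir_deriv_unip polyC (vec4 0 0 1 'X) (vec4 0 1 0 0) f.
rewrite f_inv !shift_sum_vec4 !addr0 !add0r !dir_deriv_vec4 in E.
rewrite !mul0r !mul1r !addr0 !add0r !on_line34_shift in E.
by rewrite /fdiff -[X in _ - X]/(mmap _ _ _) E opprD addrA subrr add0r.
Qed.

Lemma size_line34 g e : g \is e.-homog -> (size (on_line34 g) <= e.+1)%N.
Proof. by move=> ge; apply/leq_sizeP => j ltj; rewrite (coef_on_line34 _ ge) leqNgt ltj. Qed.

Lemma size_line23 g e : g \is e.-homog -> (size (on_line23 g) <= e.+1)%N.
Proof. by move=> ge; apply/leq_sizeP => j ltj; rewrite (coef_on_line23 _ ge) leqNgt ltj. Qed.

Lemma iter_shift_vec4 k (a b c e : F) : iter k (@shift_sum 3 F) (vec4 a b c e) =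
  vec4 a (b + a * k%:R) (c + b * k%:R + a * 'C(k, 2)%:R)
       (e + c * k%:R + b * 'C(k, 2)%:R + a * 'C(k, 3)%:R).
Proof.
elim: k => [|k IHk]; first by rewrite !bin0n !mulr0 !addr0.
rewrite iterS IHk shift_sum_vec4 !binS bin1 !natrD -!natr1.
congr (vec4 _ _ _ _); ring.
Qed.

Lemma bin2_natr k : 2%:R * 'C(k, 2)%:R = k%:R * (k%:R - 1) :> F.
Proof.
elim: k => [|k IHk]; first by rewrite bin0n mulr0 mul0r.
by rewrite binS bin1 natrD mulrDr IHk -natr1; ring.
Qed.

Lemma bin3_natr k : 6%:R * 'C(k, 3)%:R = k%:R * (k%:R - 1) * (k%:R - 2%:R) :> F.
Proof.
elim: k => [|k IHk]; first by rewrite bin0n mulr0 !mul0r.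
rewrite binS natrD mulrDr IHk (_ : 6%:R * 'C(k, 2)%:R = 3%:R * (2%:R * 'C(k, 2)%:R)); last by ring.
by rewrite bin2_natr -natr1; ring.
Qed.

Local Notation Q i := (on_line23 f^`M(i)).

(* The point (0, 2, 1 - k, 0) and the vector (6, 4 - 4k, k^2 - k, 0) are chosen so that the
   k-th iterate of the generator maps them to (0, 2, 1 + k, 0) and (6, 4 + 2k, 0, 0). *)
Lemma line23_identity (k : nat) (y := 1 - k%:R : F) (z := 1 + k%:R : F) :
  6%:R * (Q i0).[y] + (4%:R - 4%:R * k%:R) * (Q i1).[y] + (k%:R ^+ 2 - k%:R) * (Q i2).[y] =
  6%:R * (Q i0).[z] + (4%:R + 2%:R * k%:R) * (Q i1).[z].
Proof.
have iterE (h w : 'I_4 -> F) : dir_deriv idfun h w f =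
    dir_deriv idfun (iter k (@shift_sum 3 F) h) (iter k (@shift_sum 3 F) w) f.
  by elim: k {y z} => //= j ->; rewrite -{1}f_inv dir_deriv_unip.
have := iterE (vec4 0 2%:R y 0) (vec4 6%:R (4%:R - 4%:R * k%:R) (k%:R ^+ 2 - k%:R) 0).
rewrite !iter_shift_vec4.
rewrite [in X in _ = X -> _](_ : vec4 0 _ _ _ = vec4 0 2%:R z 0); last first.
  congr (vec4 _ _ _ _); rewrite ?mul0r ?addr0 // /y /z; first by ring.
  by rewrite bin2_natr; ring.
rewrite [in X in _ = X -> _](_ : vec4 6%:R _ _ _ = vec4 6%:R (4%:R + 2%:R * k%:R) 0 0); last first.
  congr (vec4 _ _ _ _); first by ring.
    rewrite (_ : 6%:R * 'C(k, 2)%:R = 3%:R * (2%:R * 'C(k, 2)%:R)); last by ring.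
    by rewrite bin2_natr; ring.
  rewrite bin3_natr (_ : (4%:R - _) * _ = (2%:R - 2%:R * k%:R) * (2%:R * 'C(k, 2)%:R)); last by ring.
  by rewrite bin2_natr; ring.
by rewrite !dir_deriv_vec4 !mul0r !addr0 -!on_line23_horner => ->.
Qed.

(** The difference of the two sides of [line23_identity], as a polynomial in k. Its degree is at
    most d + 2. *)
Let R : {poly F} :=
  6%:R *: (Q i0 \Po (1 + -1 *: 'X)) + (4%:R *: (Q i1 \Po (1 + -1 *: 'X))
  - 4%:R *: ('X * (Q i1 \Po (1 + -1 *: 'X)))) + ('X^2 * (Q i2 \Po (1 + -1 *: 'X))
  - 'X * (Q i2 \Po (1 + -1 *: 'X))) - 6%:R *: (Q i0 \Po (1 + 1 *: 'X))
  - (4%:R *: (Q i1 \Po (1 + 1 *: 'X)) + 2%:R *: ('X * (Q i1 \Po (1 + 1 *: 'X)))).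

Let sizeQ i : (size (Q i) <= d.+1)%N.
Proof. by apply: size_line23; apply: mderiv_homog. Qed.

Let coefQ_gt i c k : (d < k)%N -> (Q i \Po (1 + c *: 'X))`_k = 0.
Proof.
by move=> ltk; rewrite (coef_comp_linear c (sizeQ i)) ?(ltnW ltk) // (gtn_eqF ltk).
Qed.

Let coefR j : (d <= j)%N -> R`_j.+1 =
  - 4%:R * ((Q i1 \Po (1 + -1 *: 'X))`_j)
  + ((if j is k.+1 then (Q i2 \Po (1 + -1 *: 'X))`_k else 0) - (Q i2 \Po (1 + -1 *: 'X))`_j)
  - 2%:R * (Q i1 \Po (1 + 1 *: 'X))`_j.
Proof.
move=> ledj; have z i c : (Q i \Po (1 + c *: 'X))`_j.+1 = 0 by apply: coefQ_gt.
have zX (q : {poly F}) : ('X^2 * q)`_j.+1 = if j is k.+1 then q`_k else 0.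
  by rewrite coefXnM; case: (j) => [|k]; rewrite //= !subSS subn0.
rewrite /R; move: (z) zX.
move: (Q i0 \Po (1 + -1 *: 'X)) (Q i1 \Po (1 + -1 *: 'X)) (Q i2 \Po (1 + -1 *: 'X))
  (z i0 (-1)) (z i1 (-1)) (z i0 1) (z i1 1) => q0 q1 q2 z1 z2.
move: (Q i0 \Po (1 + 1 *: 'X)) (Q i1 \Po (1 + 1 *: 'X)) => q3 q4 z3 z4 _ zX.
rewrite coefB coefB coefD coefD coefB coefB coefD !coefZ zX !coefXM z1 z2 z3 z4.
by rewrite [_.+1 == 0]/= succnK !mulr0 !add0r subr0 mulNr.
Qed.

(** A polynomial of degree less than p that vanishes on the prime field is zero. *)
Let R_eq0 : (d.+3 <= p)%N -> R = 0.
Proof.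
move=> led; apply: (poly_vanish_prime_subfield charF) => [|k].
  apply: leq_trans led; apply/leq_sizeP => -[|[|j]] // ltj.
  have ltj1 : (d < j.+1)%N by lia.
  have ltj0 : (d < j)%N by lia.
  by rewrite (coefR (ltnW ltj1)) !coefQ_gt // !mulr0 subrr addr0 subr0.
have hc c (q : {poly F}) : (q \Po (1 + c *: 'X)).[k%:R] = q.[1 + c * k%:R].
  by rewrite horner_comp hornerD hornerZ hornerX -[1 in LHS]/(1%:P) hornerC.
have := line23_identity k.
rewrite /R !(hornerD, hornerN, hornerZ, hornerM, hornerXn, hornerX, hc) mulN1r mul1r => E.
by move/eqP: E; rewrite -subr_eq0 => /eqP E; rewrite -[RHS]E; ring.
Qed.

Lemma mnm4DU a b c e : [/\ (mnm4 a b c e + U_(i1))%MM = mnm4 a b.+1 c e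
  & (mnm4 a b c e + U_(i2))%MM = mnm4 a b c.+1 e].
Proof.
by split; apply/mnmP => -[[|[|[|[|k]]]] lt] //; rewrite mnmDE mnm1E !mnmE /= ?addn0 ?addn1.
Qed.

(** In degree d + 2 of R only X^2 Q2(1 - X) contributes, where Q2 is the restricted
    X3-derivative. *)
Let Q2_top : (d.+3 <= p)%N -> (Q i2)`_d = 0.
Proof.
move=> led; have := coefR (leqnSn d); rewrite (R_eq0 led) coef0.
rewrite !(coef_comp_linear _ (sizeQ _)) ?leqnn //; try exact: leqW.
rewrite (gtn_eqF (ltnSn d)) eqxx !mulr0 !subr0 add0r => /esym/eqP.
by rewrite mulf_eq0 signr_eq0 /= => /eqP.
Qed.

(** The coefficient of degree d in the restricted X3-derivative is d + 1 times the one sought, and d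
    + 1 is invertible. *)
Lemma coef_inv_x3 : (d.+3 <= p)%N -> f@_(mnm4 0 0 d.+1 0) = 0.
Proof.
move=> led; have := Q2_top led.
rewrite (coef_on_line23 _ (mderiv_homog i2)) leqnn subnn expr0 mul1r mcoeff_mderiv.
have [_ ->] := mnm4DU 0 0 d 0; rewrite mnmE /= -mulr_natr => /eqP.
by rewrite mulf_eq0 [_.+1%:R == 0](negbTE (natr_neq0 charF _)) ?orbF; [move/eqP | lia].
Qed.

(** With the top coefficient of the X3-derivative gone, the coefficient of degree d + 1 in R is, up
    to sign, 2 b ((-1)^d (d+2) + 1). The bracket is d + 3 or -(d + 1) according to the parity of d;
    at d = p - 3 it would be p = 0, which is where X2 X3^(p-3) enters the ideal. *)
Lemma coef_inv_x2x3 : (d.+4 <= p)%N -> f@_(mnm4 0 1 d 0) = 0.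
Proof.
move=> led; have := coefR (leqnn d); rewrite (R_eq0 (ltnW led)) coef0.
have Q2d := Q2_top (ltnW led).
rewrite !(coef_comp_linear _ (sizeQ _)) // eqxx Q2d mulr0 subr0 expr1n mul1r.
have -> : (Q i1)`_d = f@_(mnm4 0 1 d 0).
  rewrite (coef_on_line23 _ (mderiv_homog i1)) leqnn subnn expr0 mul1r mcoeff_mderiv.
  by have [-> _] := mnm4DU 0 0 d 0; rewrite mnmE.
set b := f@_ _; set t : F := match d with 0%N => _ | _ => _ end.
(* The X3-derivative of b X2 X3^d contributes d b X2 X3^(d-1), and X2 = 2 on the line. For d = 0
   there is no such term, in agreement with the factor d. *)
have -> : t = - (-1) ^+ d * 2%:R * d%:R * b.
  rewrite /t /b; case: (d) sizeQ Q2d mderiv_homog => [|k] szQ Q2k fi_homog; first by rewrite mulr0 mul0r.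
  have szQ2 : (size (Q i2) <= k.+1)%N.
    apply/leq_sizeP => j; rewrite leq_eqVlt => /orP[/eqP<- //|lt].
    by rewrite nth_default // (leq_trans (szQ i2)).
  rewrite (coef_comp_linear _ szQ2) // eqxx (coef_on_line23 _ (fi_homog i2)) leqnSn subSnn.
  rewrite mcoeff_mderiv; have [_ ->] := mnm4DU 0 1 k 0.
  by rewrite mnmE /= [(-1) ^+ k.+1]exprS -[_ *+ k.+1]mulr_natr; ring.
move=> E; have {E} : b * (2%:R * ((-1) ^+ d * (d%:R + 2%:R) + 1)) = 0.
  by rewrite -[RHS]oppr0 [in RHS]E; ring.
move/eqP; rewrite !mulf_eq0 => /orP[/eqP //|/orP[|]].
  by rewrite (negbTE (natr_neq0 charF _)) //; lia.
rewrite -signr_odd; case: (odd d); rewrite ?expr0 ?expr1.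
  rewrite (_ : _ + 1 = - d.+1%:R) ?oppr_eq0; last by rewrite -natr1; ring.
  by rewrite (negbTE (natr_neq0 charF _)) //; lia.
rewrite (_ : _ + 1 = d.+3%:R); last by rewrite -addn3 natrD; ring.
by rewrite (negbTE (natr_neq0 charF _)) //; lia.
Qed.

Let p_pr : prime p := pcharf_prime charF.

Let coef_line34_deriv2 j : (j <= d)%N ->
  (on_line34 f^`M(i2))`_j = (on_line34 f)`_j *+ (d - j).+1.
Proof.
move=> lej; rewrite (coef_on_line34 _ (mderiv_homog i2)) lej mcoeff_mderiv.
have [_ ->] := mnm4DU 0 0 (d - j) j; rewrite (coef_on_line34 _ f_homog) leqW // mnmE /=.
by rewrite subSn.
Qed.

Let coef_line34_deriv1 j : (j <= d)%N ->
  (on_line34 f^`M(i1))`_j = f@_(mnm4 0 1 (d - j) j).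
Proof.
move=> lej; rewrite (coef_on_line34 _ (mderiv_homog i1)) lej mcoeff_mderiv.
by have [-> _] := mnm4DU 0 0 (d - j) j; rewrite mnmE.
Qed.

(** The restriction to the line (0, 0, 1, t) is periodic of degree less than 2p, so its coefficients
    strictly between 1 and p vanish. If j = 1 the degree is below p and the restriction is
    constant. *)
Lemma coef_inv_x3x4 a j : (a + j = d.+1)%N -> (a <= p - 2)%N -> (0 < j < p)%N ->
  f@_(mnm4 0 0 a j) = 0.
Proof.
move=> aj lea /andP[j0 ltj].
have -> : f@_(mnm4 0 0 a j) = (on_line34 f)`_j.
  by rewrite (coef_on_line34 _ f_homog) -aj leq_addl addnK.
have szf := size_line34 f_homog.
have [lt1|le1] := ltnP 1 j.
  by apply: (periodic_coef charF fdiff_line34); [apply: leq_trans szf _; lia | rewrite lt1].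
rewrite nth_default // (leq_trans (periodic_const charF fdiff_line34 _)) //.
apply: leq_trans szf _; lia.
Qed.

(** The restricted X2-derivative P has the known difference -Z(t + 1). Subtracting an explicit
    polynomial with that difference leaves a periodic one, whose coefficient of degree j is zero. *)
Lemma coef_inv_x2x3x4 a j : (a + j = d)%N -> (a <= p - 4)%N -> (0 < j < p)%N ->
  f@_(mnm4 0 1 a j) = 0.
Proof.
move=> aj lea /andP[j0 ltj].
have -> : f@_(mnm4 0 1 a j) = (on_line34 f^`M(i1))`_j.
  by rewrite coef_line34_deriv1 -aj ?leq_addl // addnK.
have szf := size_line34 f_homog; have szf1 := size_line34 (mderiv_homog i1).
have szf2 := size_line34 (mderiv_homog i2).
have dP := fdiff_line34_deriv; set P := on_line34 f^`M(i1) in dP szf1 *.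
set Z := on_line34 f^`M(i2) in dP szf2.
(* If d + 1 < p, the restriction of f is constant, hence so is Z, and P + e t is constant. Only j =
   1 needs an argument: there e is a multiple of the coefficient of X3^(d+1), which is zero. *)
have [ged|ltd] := leqP p d.+1; last first.
  have f0 : (size (on_line34 f) <= 1)%N.
    by apply: (periodic_const charF fdiff_line34); apply: leq_trans szf _; lia.
  have [e Ze] : exists e, Z = e%:P.
    exists Z`_0; apply: size1_polyC; apply/leq_sizeP => k k0.
    have [lek|ltk] := leqP k d; last by rewrite nth_default // (leq_trans szf2).
    by rewrite /Z coef_line34_deriv2 // nth_default ?mul0rn // (leq_trans f0).
  have dQ : fdiff (P - - e *: 'X) = 0.
    rewrite fdiffB dP fdiffZ Ze comp_polyC /fdiff comp_polyX addrAC subrr add0r.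
    by rewrite alg_polyC polyCN opprK addNr.
  have szQ : (size (P - - e *: 'X)%R <= p)%N.
    rewrite (leq_trans (size_polyD _ _)) // geq_max size_polyN; apply/andP; split; first by lia.
    by rewrite (leq_trans (size_scale_leq _ _)) // size_polyX; lia.
  have Qj : (P - - e *: 'X)`_j = 0.
    by rewrite nth_default // (leq_trans (periodic_const charF dQ szQ)).
  have -> : P = (P - - e *: 'X) + - e *: 'X by rewrite subrK.
  rewrite coefD Qj add0r coefZ coefX; case: eqP => j1; last by rewrite mulr0.
  have -> : e = Z`_0 by rewrite Ze coefC.
  rewrite coef_line34_deriv2 // (coef_on_line34 _ f_homog) subn0 coef_inv_x3 ?mul0rn ?oppr0 ?mul0r //; lia.
have p1 := prime_gt1 p_pr.
have szfp : (size (on_line34 f) <= p.+1)%N.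
  apply: (size_periodic (n := (2 * p).-1) fdiff_line34); first by apply: leq_trans szf _; lia.
  by move=> i ip; apply: (natrD_neq0 charF); lia.
have [e0 [e1 [e2 Ze]]] : exists e0 e1 e2, Z = e0%:P + e1 *: 'X + e2 *: 'X^p.
  exists Z`_0, Z`_1, Z`_p; apply/polyP => k.
  rewrite !coefD coefC !coefZ coefX coefXn.
  have [->|k0] := eqVneq k 0%N.
    by rewrite (ltn_eqF (ltnW p1)) !mulr0 !addr0.
  have [->|k1] := eqVneq k 1%N; first by rewrite (ltn_eqF p1) mulr1 mulr0 add0r addr0.
  rewrite mulr0 !add0r; have [->|kp] := eqVneq k p; first by rewrite mulr1.
  rewrite mulr0; have [lek|ltk] := leqP k d; last by rewrite nth_default // (leq_trans szf2).
  rewrite /Z coef_line34_deriv2 //; have [ltkp|ltpk] := ltnP k p; last first.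
    by rewrite nth_default ?mul0rn // (leq_trans szfp) // ltn_neqAle eq_sym kp.
  rewrite (periodic_coef charF fdiff_line34) ?mul0rn //; [apply: leq_trans szf _; lia | lia].
(* A, B and -e2 are the coefficients of t, t^2 and t^(p+1) in a polynomial with difference -Z(t +
   1); they come from the fact that t^(p+1) has difference t^p + t + 1. *)
have F2 : 2%:R != 0 :> F by apply: (natr_neq0 charF); lia.
pose B := (e2 - e1) / 2%:R; have e1E : e1 = e2 - 2%:R * B by rewrite /B; field.
pose A := - (e0 + e1) - B.
pose Q := P - (A%:P * 'X + B%:P * 'X^2 - e2%:P * ('X^p * 'X)).
have dQ : fdiff Q = 0.
  have -> : fdiff Q = fdiff P - (fdiff (A%:P * 'X) + fdiff (B%:P * 'X^2) - fdiff (e2%:P * ('X^p * 'X))).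
    by rewrite /fdiff !raddfB raddfD /=; ring.
  rewrite dP Ze /fdiff -!mul_polyC !(comp_polyD, comp_polyM, comp_polyC, comp_polyX, comp_Xn_poly).
  by rewrite (XD1_frob charF) /A e1E !(polyCB, polyCD, polyCM, polyCN); ring.
have szQ : (size Q <= 2 * p)%N.
  apply/leq_sizeP => k lek; rewrite !(coefB, coefD) !coefCM -exprSr coefX !coefXn.
  rewrite nth_default; last by apply: leq_trans szf1 _; lia.
  have ltk : (p.+1 < k)%N by move: lek p_ge5; clear; lia.
  have ltk2 : (2 < k)%N by move: ltk p1; clear; lia.
  by rewrite (gtn_eqF ltk) (gtn_eqF ltk2) (gtn_eqF (ltnW ltk2)) !mulr0 !addr0 !subrr.
(* As a <= p - 4 and a + j >= p - 1, the index j avoids the degrees 1, 2 and p + 1 of the subtracted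
   polynomial. *)
have j2 : (2 < j)%N by move: aj lea ged p_ge5; clear; lia.
have : Q`_j = 0 by apply: (periodic_coef charF dQ szQ); rewrite (ltnW j2).
rewrite !(coefB, coefD) !coefCM -exprSr coefX !coefXn.
have ltjp1 : (j < p.+1)%N by exact: leqW.
by rewrite (ltn_eqF ltjp1) (gtn_eqF j2) (gtn_eqF (ltnW j2)) !mulr0 !addr0 !subr0.
Qed.

End InvariantCoefficients.

(* The monomials outside the monomial ideal (x1, x2^2, x2 x3^(p-3), x3^(p-1), x4^p), which turns
   out to be the Hilbert ideal. *)
Definition reduced (p : nat) (m : 'X_{1..4}) : bool :=
  [&& m (@Ordinal 4 0 isT) == 0, m (@Ordinal 4 1 isT) <= 1,
      m (@Ordinal 4 2 isT) + 2 * m (@Ordinal 4 1 isT) <= p - 2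
    & m (@Ordinal 4 3 isT) < p]%N.

Lemma reduced_mnm4 p a b c e : reduced p (mnm4 a b c e) =
  [&& a == 0, b <= 1, c + 2 * b <= p - 2 & e < p]%N.
Proof. by rewrite /reduced !mnmE. Qed.

Lemma reducedDl p m1 m2 : reduced p (m1 + m2)%MM -> reduced p m1.
Proof.
elim/mnm4_ind: m1 => a b c e; elim/mnm4_ind: m2 => a' b' c' e'.
by rewrite /reduced !mnmDE !mnmE /=; lia.
Qed.

(** The four cases, X2 present or not and X4 present or not, are the four preceding vanishing
    lemmas. *)
Lemma coef_invariant_reduced (F : fieldType) p (f : {mpoly F[4]}) d m :
  p \in [pchar F] -> (5 <= p)%N -> f \is d.-homog -> (0 < d)%N -> unip_subst f = f ->
  reduced p m -> f@_m = 0.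
Proof.
move=> charF p5; case: d => // d fd _ finv rm.
have [dm|ne] := eqVneq (mdeg m) d.+1; last exact: (dhomog_nemf_coeff fd ne).
elim/mnm4_ind: m rm dm => a b c e; rewrite reduced_mnm4 mdeg_mnm4 => /and4P[/eqP-> b1 cb ep].
have [->|e0] := posnP e; case: b b1 cb => [|[|//]] _ cb; rewrite ?addn0 ?add0n => E.
- by rewrite E (coef_inv_x3 charF p5 fd finv) //; lia.
- have -> : c = d by lia.
  by rewrite (coef_inv_x2x3 charF p5 fd finv) //; lia.
- by apply: (coef_inv_x3x4 charF p5 fd finv) => //; lia.
- by apply: (coef_inv_x2x3x4 charF p5 fd finv) => //; lia.
Qed.

(** * The Hilbert ideal contains no reduced monomial *)

Section HilbertIdeal.
Variables (F : fieldType) (p : nat).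
Hypotheses (charF : p \in [pchar F]) (p_ge5 : (5 <= p)%N).
Variables (X1 X2 X3 X4 : 'rV[F]_4).
Hypothesis X_basis : basis_of fullv [:: X1; X2; X3; X4].
Hypotheses (DX1 : Delta p X1 = 0) (DX2 : Delta p X2 = X1).
Hypotheses (DX3 : Delta p X3 = X2) (DX4 : Delta p X4 = X3).

Local Notation rho := (V_rho F p 4).

Definition basis_mx : 'M[F]_4 := \matrix_(i < 4) vec4 X1 X2 X3 X4 i.

(** The dual action multiplies row vectors by the matrix of the inverse element. *)
Definition gen_mx : 'M[F]_4 := rho ((Zp_gen p)^-1)%g.

Lemma basis_mx_unit : basis_mx \in unitmx.
Proof.
rewrite -row_free_unit; apply/inj_row_free => v vB.
have /andP[_ fr] := X_basis.
have fr' : free (in_tuple [:: X1; X2; X3; X4]) by [].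
move/freeP: fr' => /(_ (fun i => v 0 i)) H.
apply/rowP => i; rewrite mxE; apply: H => /=.
rewrite -[RHS]vB mulmx_sum_row; apply: eq_bigr => j _; rewrite rowK.
by case: j => [[|[|[|[|k]]]] lt].
Qed.

Lemma unip_subst_lsub (f : {mpoly F[4]}) :
  unip_subst f = lsub (\matrix_(i < 4, j < 4) ((i == j)%:R + (i == j.+1 :> nat)%:R)) f.
Proof.
rewrite /unip_subst /lsub; congr (f \mPo _); apply: eq_mktuple => i.
rewrite /linear_form /shift_sum.
under [RHS]eq_bigr do rewrite !mxE scalerDl.
rewrite big_split /= (bigD1 i) //= eqxx scale1r big1 ?addr0; last first.
  by move=> j ne; rewrite eq_sym (negbTE ne) scale0r.
congr (_ + _); case: i => [[|k] lt] /=; first by rewrite big1 // => j _; rewrite scale0r.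
rewrite (bigD1 (inord k)) //= inordK ?eqxx ?scale1r; last exact: ltnW.
rewrite big1 ?addr0 // => j ne; rewrite (_ : (_ == _) = false) ?scale0r //.
apply: contraNF ne => /eqP[->]; by rewrite inord_val.
Qed.

Lemma basis_mx_gen :
  basis_mx *m gen_mx = (\matrix_(i < 4, j < 4) ((i == j)%:R + (i == j.+1 :> nat)%:R)) *m basis_mx.
Proof.
have D Y Z : Delta p Y = Z -> Y *m gen_mx = Y + Z.
  by move=> <-; rewrite /Delta /dual_act -/gen_mx addrC subrK.
apply/row_matrixP => i; rewrite !row_mul rowK [RHS]mulmx_sum_row !big_ord_recl big_ord0 !mxE !rowK.
by case: i => [[|[|[|[|k]]]] lt] //; rewrite /vec4 /= ?(D _ _ DX1) ?(D _ _ DX2) ?(D _ _ DX3) ?(D _ _ DX4)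
  ?(add0r, addr0, scale0r, scale1r) //; rewrite addrC.
Qed.

Lemma poly_act_gen (f : {mpoly F[4]}) : poly_act rho (Zp_gen p) (lsub basis_mx f) = lsub basis_mx (unip_subst f).
Proof. by rewrite poly_act_lsub lsub_comp unip_subst_lsub lsub_comp -basis_mx_gen. Qed.

(** A reduced monomial of a product a h is a multiple of some monomial of h, itself reduced because
    divisors of reduced monomials are reduced; but the invariant h has no reduced monomial. *)
Lemma hilbert_ideal_coef (f : {mpoly F[4]}) m : f \in hilbert_ideal rho -> reduced p m ->
  (lsub (invmx basis_mx) f)@_m = 0.
Proof.
move=> /boolp.asboolP[k [a [h [hh ->]]]] rm.
rewrite (_ : lsub _ _ =
  \sum_(i < k) lsub (invmx basis_mx) (a i) * lsub (invmx basis_mx) (h i)); last first.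
  by rewrite /lsub raddf_sum; apply: eq_bigr => i _; apply: rmorphM.
rewrite raddf_sum big1 //= => i _; rewrite mcoeffMr big1 // => -[m1 m2] /= /eqP Em.
have [d [d0 hd hinv]] := hh i.
rewrite (coef_invariant_reduced charF p_ge5 (lsub_homog _ hd) d0) ?mul0r ?mulr0 //; last first.
  by apply: (@reducedDl p _ m2); move: rm; rewrite {1}Em.
(* In the adapted coordinates, invariance under the generator becomes invariance under [unip_subst],
   because the change of coordinates is injective. *)
set g := lsub _ _.
have inj : injective (lsub basis_mx).
  apply: (can_inj (g := lsub (invmx basis_mx))) => q.
  by rewrite lsub_comp mulmxV ?basis_mx_unit // lsub1.
apply: inj; rewrite -poly_act_gen /g lsub_comp mulVmx ?basis_mx_unit // lsub1.
exact: hinv.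
Qed.

End HilbertIdeal.

(** * The coinvariants *)

Section CoinvariantAlgebra.
Variables (F : fieldType) (gT : finGroupType) (n : nat) (rho : gT -> 'M[F]_n).

HB.instance Definition _ := GRing.Lalgebra_isComAlgebra.Build F (coinv rho).

HB.instance Definition _ (x : gT) := GRing.LRMorphism.copy (poly_act rho x)
  (comp_mpoly [tuple linear_form (dual_act rho x (delta_mx 0 i)) | i < n]).

Lemma coinv_pi_surj (c : coinv rho) : exists f, c = coinv_pi rho f.
Proof. by exists (repr c); rewrite /coinv_pi reprK. Qed.

Lemma coinv_pi_eq0 f : coinv_pi rho f = 0 <-> f \in hilbert_ideal rho.
Proof.
rewrite -[in X in _ <-> X](subr0 f) Quotient.idealrBE -(rmorph0 (coinv_pi rho)).
by split=> [/eqP|/eqP].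
Qed.

Lemma coinv_pi_hilbert_gen h : hilbert_gen rho h -> coinv_pi rho h = 0.
Proof.
move=> hh; apply/coinv_pi_eq0/boolp.asboolP; exists 1%N, (fun=> 1), (fun=> h).
by split=> //; rewrite big_ord1 mul1r.
Qed.

Section Action.
Variable x : gT.

Lemma coinv_act_zmod : zmod_morphism (coinv_act rho x).
Proof.
move=> c1 c2; have [f ->] := coinv_pi_surj c1; have [g ->] := coinv_pi_surj c2.
by rewrite -raddfB !coinv_actE -raddfB /= raddfB.
Qed.

Lemma coinv_act_monoid : monoid_morphism (coinv_act rho x).
Proof.
split=> [|c1 c2]; first by rewrite -(rmorph1 (coinv_pi rho)) coinv_actE [poly_act rho x 1]rmorph1.
have [f ->] := coinv_pi_surj c1; have [g ->] := coinv_pi_surj c2.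
by rewrite -rmorphM !coinv_actE /= [in LHS]rmorphM /= rmorphM.
Qed.

Lemma coinv_act_scalable : scalable (coinv_act rho x).
Proof.
move=> a c; have [f ->] := coinv_pi_surj c.
by rewrite -linearZ !coinv_actE -linearZ /= linearZ.
Qed.

HB.instance Definition _ := GRing.isZmodMorphism.Build _ _ (coinv_act rho x) coinv_act_zmod.
HB.instance Definition _ := GRing.isMonoidMorphism.Build _ _ (coinv_act rho x) coinv_act_monoid.
HB.instance Definition _ := GRing.isScalable.Build F _ _ _ (coinv_act rho x) coinv_act_scalable.

End Action.

End CoinvariantAlgebra.

(** * The group action as iteration of the generator *)

Section CyclicAction.
Variables (F : fieldType) (p n : nat).
Hypotheses (charF : p \in [pchar F]) (le_np : (n <= p)%N).

Local Notation rho := (V_rho F p n).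

Let p_gt1 : (1 < p)%N := prime_gt1 (pcharf_prime charF).

Lemma V_rho_expg (x : 'Z_p) k : rho (x ^+ k)%g = rho x ^+ k.
Proof.
have [r1 rM] := V_rho_repr charF le_np.
elim: k => [|k IHk]; first by rewrite expg0 r1 expr0.
by rewrite expgS rM ?inE // IHk exprS.
Qed.

Lemma Zp_gen_expg (x : 'Z_p) : (Zp_gen p ^+ x)%g = x.
Proof. by rewrite Zp_expg mul1n valZpK. Qed.

Lemma iter_poly_act x k f : iter k (poly_act rho x) f = lsub (rho (x^-1 ^+ k)%g) f.
Proof.
elim: k => [|k IHk]; first by rewrite V_rho_expg expr0 lsub1.
by rewrite iterS IHk poly_act_lsub lsub_comp !V_rho_expg mulmxE -exprSr.
Qed.

Lemma poly_act_iter x f : poly_act rho x f = iter x (poly_act rho (Zp_gen p)) f.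
Proof. by rewrite iter_poly_act expgVn Zp_gen_expg poly_act_lsub. Qed.

Lemma iter_poly_act_p f : iter p (poly_act rho (Zp_gen p)) f = f.
Proof.
rewrite iter_poly_act (_ : (_ ^+ p)%g = 1%g); last first.
  by apply/val_inj; rewrite Zp_expg /= Zp_cast // modnMl.
by have [r1 _] := V_rho_repr charF le_np; rewrite [rho _]r1 lsub1.
Qed.

Lemma coinv_act_iter x c : coinv_act rho x c = iter x (coinv_act rho (Zp_gen p)) c.
Proof.
have [f ->] := coinv_pi_surj c; rewrite coinv_actE poly_act_iter.
by elim: (x : nat) => //= k <-; rewrite coinv_actE.
Qed.

Lemma invariant_gen f : poly_act rho (Zp_gen p) f = f -> Defs.invariant rho f.
Proof. by move=> fx x; rewrite poly_act_iter; elim: (x : nat) => //= k ->. Qed.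

End CyclicAction.

(** * Relations produced by invariants *)

Section Relations.
Variables (F : fieldType) (p : nat).
Hypotheses (charF : p \in [pchar F]) (p_ge5 : (5 <= p)%N).

Local Notation rho := (V_rho F p 4).
Local Notation pi := (coinv_pi rho).
Local Notation S := (poly_act rho (Zp_gen p)).
Local Notation T := (coinv_act rho (Zp_gen p)).

Let p_pr : prime p := pcharf_prime charF.
Let le4p : (4 <= p)%N := ltnW p_ge5.

Lemma coinv_pi_invariant d h : h \is d.-homog -> (0 < d)%N -> S h = h -> pi h = 0.
Proof.
move=> hd d0 Sh; apply: coinv_pi_hilbert_gen; exists d; split=> //.
exact: invariant_gen Sh.
Qed.

Lemma poly_act_homog d h : h \is d.-homog -> S h \is d.-homog.
Proof. by move=> hd; rewrite poly_act_lsub lsub_homog. Qed.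

(** D^(p-1) h is annihilated by D, because D^p = sigma^p - 1 = 0; so it is an invariant of positive
    degree. *)
Lemma pi_iterD_predp d h : h \is d.-homog -> (0 < d)%N ->
  iter p.-1 (fun c => T c - c) (pi h) = 0.
Proof.
move=> hd d0; pose D f := S f - f.
have iterDh k : iter k D h \is d.-homog.
  by elim: k => //= k IHk; rewrite rpredB ?poly_act_homog.
have -> : iter p.-1 (fun c => T c - c) (pi h) = pi (iter p.-1 D h).
  by elim: p.-1 => //= k ->; rewrite coinv_actE -raddfB.
apply: (coinv_pi_invariant (iterDh _)) => //; apply/eqP; rewrite -subr_eq0; apply/eqP.
rewrite -[LHS]/(D _) -iterS prednK ?prime_gt0 //.
by rewrite (iterD_prime _ _ charF) iter_poly_act_p // subrr.
Qed.

Lemma coef_prod_linear_homog m (l : nat -> {mpoly F[4]}) : (forall i, l i \is 1.-homog) ->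
  forall j e, (j + e = m)%N -> (\prod_(i < m) ('X - (l i)%:P))`_j \is e.-homog.
Proof.
move=> lh; elim: m => [|m IHm] j e E.
  by case: j e E => [|//] [|//] _; rewrite big_ord0 coef1 dhomog1.
rewrite big_ord_recr /= mulrBr coefB coefMX coefMC; apply: rpredB.
  by case: j E => [|j] E /=; [exact: rpred0 | apply: IHm; lia].
case: e E => [|e] E.
  rewrite nth_default ?mul0r ?rpred0 //.
  by rewrite size_prod_XsubC [index_enum _]unlock -enumT size_enum_ord; lia.
by rewrite -[e.+1]addn1; apply: dhomogM => //; apply: IHm; lia.
Qed.

Lemma prod_cyclic_shift (R : comNzRingType) (g : nat -> R) q :
  g q = g 0%N -> \prod_(k < q) g k.+1 = \prod_(k < q) g k.
Proof.
case: q => [|q] gq; first by rewrite !big_ord0.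
by rewrite big_ord_recr [RHS]big_ord_recl /= gq mulrC.
Qed.

(* The coefficients of prod_k ('X - T^k u) are invariant, so its image over the coinvariants
   is 'X^p; but u is a root. *)
Lemma pi_linear_form_expp u : pi (linear_form u) ^+ p = 0.
Proof.
have [l [l0 lS lp]] : exists l : nat -> {mpoly F[4]},
    [/\ l 0%N = linear_form u, forall k, S (l k) = l k.+1 & l p = linear_form u].
  by exists (fun k => iter k S (linear_form u)); split=> //; apply: iter_poly_act_p.
have lh k : l k \is 1.-homog.
  elim: k => [|k IHk]; first by rewrite l0 linear_form_homog.
  by rewrite -lS poly_act_homog.
pose P := \prod_(k < p) ('X - (l k)%:P).
have Sl k : map_poly S ('X - (l k)%:P) = 'X - (l k.+1)%:P.
  by rewrite rmorphB /= map_polyX map_polyC /= lS.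
have SP : map_poly S P = P.
  rewrite rmorph_prod -[RHS](@prod_cyclic_shift _ (fun k => 'X - (l k)%:P) p); last by rewrite lp l0.
  by apply: eq_bigr => i _; apply: Sl.
have mP : map_poly pi P = 'X^p.
  apply/polyP => j; rewrite coef_map coefXn /=.
  have szP : size P = p.+1 by rewrite size_prod_XsubC [index_enum _]unlock -enumT size_enum_ord.
  have Pmon : P \is monic by apply: monic_prod_XsubC.
  case: (ltngtP j p) => [ltjp|ltpj|->].
  - apply: (coinv_pi_invariant (d := p - j)); rewrite ?subn_gt0 //.
      by apply: coef_prod_linear_homog => //; rewrite subnKC // ltnW.
    by rewrite -[in RHS]SP coef_map.
  - by rewrite nth_default ?rmorph0 ?szP.
  - by have /monicP := Pmon; rewrite /lead_coef szP => ->; rewrite rmorph1.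
have P0 : P.[linear_form u] = 0.
  have h0 : ('X - (l 0%N)%:P).[linear_form u] = 0.
    by rewrite hornerXsubC l0 subrr.
  have p0 := prime_gt0 p_pr.
  rewrite /P horner_prod.
  rewrite (bigD1 (Ordinal p0) isT) /=.
  rewrite [X in X * _](_ : _ = 0); last exact: h0.
  by rewrite mul0r.
have : (map_poly pi P).[pi (linear_form u)] = 0 by rewrite horner_map P0; apply: rmorph0.
by rewrite mP hornerXn.
Qed.

End Relations.

(** * Relations and spanning monomials for V_4 *)

Section CoinvariantsV4.
Variables (F : fieldType) (p : nat).
Hypotheses (charF : p \in [pchar F]) (p_ge5 : (5 <= p)%N).
Variables (X1 X2 X3 X4 : 'rV[F]_4).
Hypothesis X_basis : basis_of fullv [:: X1; X2; X3; X4].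
Hypotheses (DX1 : Delta p X1 = 0) (DX2 : Delta p X2 = X1).
Hypotheses (DX3 : Delta p X3 = X2) (DX4 : Delta p X4 = X3).

Local Notation rho := (V_rho F p 4).
Local Notation pi := (coinv_pi rho).
Local Notation S := (poly_act rho (Zp_gen p)).
Local Notation T := (coinv_act rho (Zp_gen p)).
Local Notation C := (coinv_deg rho).
Local Notation x1 := (pi (linear_form X1)).
Local Notation x2 := (pi (linear_form X2)).
Local Notation x3 := (pi (linear_form X3)).
Local Notation x4 := (pi (linear_form X4)).
Local Notation B := (basis_mx X1 X2 X3 X4).

Lemma poly_act_form Y Z : Delta p Y = Z -> S (linear_form Y) = linear_form Y + linear_form Z.
Proof.
move=> <-; rewrite poly_act_linear_form -[dual_act _ _ _](subrK Y) -/(Delta p Y).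
by rewrite -[X in X + Y]scale1r linear_form_is_linear scale1r addrC.
Qed.

Lemma coinv_act_form Y Z : Delta p Y = Z -> T (pi (linear_form Y)) =
  pi (linear_form Y) + pi (linear_form Z).
Proof. by move=> D; rewrite coinv_actE (poly_act_form D) raddfD. Qed.

Lemma linear_form0 : linear_form 0 = 0 :> {mpoly F[4]}.
Proof. by rewrite /linear_form big1 // => i _; rewrite mxE scale0r. Qed.

Lemma x1_eq0 : x1 = 0.
Proof.
apply: (coinv_pi_invariant charF p_ge5 (linear_form_homog X1)) => //.
by rewrite (poly_act_form DX1) linear_form0 addr0.
Qed.

Lemma Tx2 : T x2 = x2. Proof. by rewrite (coinv_act_form DX2) x1_eq0 addr0. Qed.

Lemma Tx3 : T x3 = x3 + x2. Proof. exact: coinv_act_form. Qed.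

Lemma Tx4 : T x4 = x4 + x3. Proof. exact: coinv_act_form. Qed.

Lemma two_neq0 : 2%:R != 0 :> F.
Proof. by apply: (natr_neq0 charF); rewrite /= (leq_trans _ p_ge5). Qed.

Lemma x2_sqr : x2 * x2 = 0.
Proof.
pose L (Y : 'rV[F]_4) : {mpoly F[4]} := linear_form Y.
(* The terms in X1 correct X2^2 to an invariant and vanish in the coinvariants. *)
pose h := L X2 * L X2 - (L X1 * L X3) *+ 2 - L X1 * L X2.
have hd : h \is 2.-homog.
  have H Y Z : L Y * L Z \is 2.-homog by apply: (dhomogM (d := 1) (e := 1)); exact: linear_form_homog.
  by rewrite !rpredB ?rpredMn.
have h0 : pi h = 0.
  apply: (coinv_pi_invariant charF p_ge5 hd) => //.
  rewrite /h !rmorphB rmorphMn /= !rmorphM /= /L (poly_act_form DX1) (poly_act_form DX2) (poly_act_form DX3).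
  by rewrite linear_form0; ring.
by rewrite -h0 /h !rmorphB rmorphMn /= !rmorphM /= x1_eq0 !mul0r mul0rn !subr0.
Qed.

Let pow_homog (Y : 'rV[F]_4) k : linear_form Y ^+ k \is k.-homog.
Proof. by have := dhomogMn k (linear_form_homog Y); rewrite mul1n. Qed.

(** D^(p-1) x4^(p-2) is zero, yet equals ((p-2) (p-1)!/2) x2 x3^(p-3), with an invertible scalar. *)
Lemma x2x3_rel : x2 * x3 ^+ (p - 4).+1 = 0.
Proof.
have d0 : (0 < p - 2)%N by lia.
have := iterD_x4 two_neq0 x2_sqr Tx2 Tx3 Tx4 d0.
have -> : (p - 2).+1 = p.-1 by lia.
rewrite -rmorphXn (pi_iterD_predp charF p_ge5 (pow_homog X4 _)) // => /esym/eqP.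
rewrite scaler_eq0 => /orP[|/eqP E]; last by rewrite -E; congr (_ * _ ^+ _); lia.
rewrite mulf_eq0 invr_eq0 (negbTE two_neq0) natrM mulf_eq0.
rewrite (negbTE (natr_neq0 charF _)) ?(negbTE (fact_neq0 charF _)) //; lia.
Qed.

(** By the preceding relation D^(p-1) x4^(p-1) is (p-1)! x3^(p-1); it is also zero. *)
Lemma x3_rel : x3 ^+ (p - 4).+3 = 0.
Proof.
have d1 : (1 < p.-1)%N by lia.
have E : x2 * x3 ^+ p.-1.-2 = 0 by rewrite -[RHS]x2x3_rel; congr (_ * _ ^+ _); lia.
have := iterD_x4_top two_neq0 x2_sqr Tx2 Tx3 Tx4 d1 E.
rewrite -rmorphXn (pi_iterD_predp charF p_ge5 (pow_homog X4 _)); last lia.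
rewrite -scaler_nat => /esym/eqP; rewrite scaler_eq0.
rewrite (negbTE (fact_neq0 charF _)) /=; last lia.
by move/eqP => E'; rewrite -[RHS]E'; congr (_ ^+ _); lia.
Qed.

Lemma x4_rel : x4 ^+ p = 0.
Proof. exact: pi_linear_form_expp. Qed.

Lemma pi_lsub_mnm4 a b c e :
  pi (lsub B 'X_[mnm4 a b c e]) = x1 ^+ a * x2 ^+ b * x3 ^+ c * x4 ^+ e.
Proof.
rewrite /lsub comp_mpolyX !big_ord_recl big_ord0 mulr1 !tnth_mktuple !mnmE !rowK /vec4 /=.
by rewrite !rmorphM !rmorphXn /= !mulrA.
Qed.

Lemma coinv_reduced_free q m : pi (lsub B q) = 0 -> reduced p m -> q@_m = 0.
Proof.
move/coinv_pi_eq0 => qI rm; have := hilbert_ideal_coef charF p_ge5 X_basis DX1 DX2 DX3 DX4 qI rm.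
by rewrite lsub_comp mulmxV ?basis_mx_unit // lsub1.
Qed.

Lemma coinv_deg_closed d a x y : C d x -> C d y -> C d (a *: x + y).
Proof.
move=> [f fd ->] [g gd ->]; exists (a *: f + g); last by rewrite linearP.
by rewrite rpredD ?rpredZ.
Qed.

Lemma coinv_deg0 d : C d 0.
Proof. by exists 0; rewrite ?rpred0 ?raddf0. Qed.

Lemma coinv_degT d x : C d x -> C d (T x).
Proof. by move=> [f fd ->]; exists (S f); rewrite ?coinv_actE ?poly_act_homog. Qed.

Lemma coinv_deg_mul a b x y : C a x -> C b y -> C (a + b)%N (x * y).
Proof. by move=> [f fd ->] [g gd ->]; exists (f * g); rewrite ?rmorphM // dhomogM. Qed.

Lemma coinv_deg_exp (Y : 'rV[F]_4) k : C k (pi (linear_form Y) ^+ k).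
Proof. by exists (linear_form Y ^+ k); rewrite ?rmorphXn. Qed.

Lemma coinv_deg_mon34 a b d : (a + b = d)%N -> C d (x3 ^+ a * x4 ^+ b).
Proof. by move=> <-; apply: coinv_deg_mul; exact: coinv_deg_exp. Qed.

Lemma coinv_deg_mon234 a b d : (a + b).+1 = d -> C d (x2 * x3 ^+ a * x4 ^+ b).
Proof.
move=> <-; rewrite -mulrA -[(a + b).+1]add1n; apply: coinv_deg_mul; first exact: (coinv_deg_exp X2 1).
exact: coinv_deg_mon34.
Qed.

(** Every other monomial is divisible by one of x1, x2^2, x2 x3^(p-3), x3^(p-1), x4^p, all zero. The
    family e lets each degree enumerate the remaining ones in its own order. *)
Lemma coinv_deg_span d N (e : 'I_N -> coinv rho) :
  (forall a b, (a + b)%N = d -> (a <= p - 2)%N -> (b < p)%N ->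
     exists j, x3 ^+ a * x4 ^+ b = e j) ->
  (forall a b, (a + b).+1 = d -> (a <= p - 4)%N -> (b < p)%N ->
     exists j, x2 * x3 ^+ a * x4 ^+ b = e j) ->
  forall c, C d c -> exists v : 'rV[F]_N, c = \sum_j v 0 j *: e j.
Proof.
move=> H1 H2 _ [f fd ->].
have [g gd ->] : exists2 g, g \is d.-homog & f = lsub B g.
  exists (lsub (invmx B) f); first exact: lsub_homog.
  by rewrite lsub_comp mulVmx ?basis_mx_unit // lsub1.
have ze : exists v : 'rV[F]_N, 0 = \sum_j v 0 j *: e j.
  by exists 0; rewrite big1 // => j _; rewrite mxE scale0r.
have se j : exists v : 'rV[F]_N, e j = \sum_j v 0 j *: e j.
  exists (delta_mx 0 j); rewrite (bigD1 j) //= mxE !eqxx scale1r big1 ?addr0 // => i ne.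
  by rewrite mxE (negbTE ne) scale0r.
rewrite /lsub comp_mpolyEX raddf_sum big_seq; elim/big_rec: _ => // m c mg [v ->].
have [w E] : exists w : 'rV[F]_N, pi (lsub B 'X_[m]) = \sum_j w 0 j *: e j.
  have := dhomog_mf gd mg; elim/mnm4_ind: m {mg} => a b k l; rewrite /= mdeg_mnm4 pi_lsub_mnm4 x1_eq0.
  case: a => [|a] E; last by rewrite exprS !mul0r.
  rewrite expr0 mul1r; have [lel|ltl] := leqP p l.
    by rewrite -(subnKC lel) exprD x4_rel mul0r mulr0.
  case: b E => [|[|b]] E; last by rewrite 2!exprS (mulrA x2) x2_sqr !mul0r.
    rewrite expr0 mul1r; have [lek|ltk] := leqP k (p - 2).
      by have [|//||j ->] := H1 k l; [lia | | exact: se].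
    by rewrite (x3_eq0 x3_rel) //; lia.
  rewrite expr1; have [lek|ltk] := leqP k (p - 4).
    by have [|//||j ->] := H2 k l; [lia | | exact: se].
  by rewrite (x2x3_eq0 x2x3_rel).
exists (g@_m *: w + v); rewrite /= linearZ /= -/(lsub B _) E scaler_sumr -big_split.
by apply: eq_bigr => j _ /=; rewrite !mxE scalerDl scalerA.
Qed.

End CoinvariantsV4.

(** * Decomposition of the homogeneous components *)

Section HomogeneousComponents.
Variables (F : fieldType) (p : nat).
Hypotheses (charF : p \in [pchar F]) (p_ge5 : (5 <= p)%N).
Variables (X1 X2 X3 X4 : 'rV[F]_4).
Hypothesis X_basis : basis_of fullv [:: X1; X2; X3; X4].
Hypotheses (DX1 : Delta p X1 = 0) (DX2 : Delta p X2 = X1).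
Hypotheses (DX3 : Delta p X3 = X2) (DX4 : Delta p X4 = X3).

Local Notation rho := (V_rho F p 4).
Local Notation pi := (coinv_pi rho).
Local Notation act := (coinv_act rho).
Local Notation T := (coinv_act rho (Zp_gen p)).
Local Notation D := (fun c : coinv rho => T c - c).
Local Notation C := (coinv_deg rho).
Local Notation gen := (cyclic_submodule act).
Local Notation V := (V_act F p).
Local Notation x2 := (pi (linear_form X2)).
Local Notation x3 := (pi (linear_form X3)).
Local Notation x4 := (pi (linear_form X4)).
Local Notation B := (basis_mx X1 X2 X3 X4).

Let p_gt1 : (1 < p)%N := prime_gt1 (pcharf_prime charF).
Let le4p : (4 <= p)%N := ltnW p_ge5.
Let F2 : 2%:R != 0 :> F := two_neq0 charF p_ge5.
Let Ux2 : T x2 = x2 := Tx2 charF p_ge5 DX1 DX2.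
Let Ux3 : T x3 = x3 + x2 := Tx3 DX3.
Let Ux4 : T x4 = x4 + x3 := Tx4 DX4.
Let xx2 : x2 * x2 = 0 := x2_sqr charF p_ge5 DX1 DX2 DX3.
Let rel2 : x2 * x3 ^+ (p - 4).+1 = 0 := x2x3_rel charF p_ge5 X_basis DX1 DX2 DX3 DX4.
Let rel3 : x3 ^+ (p - 4).+3 = 0 := x3_rel charF p_ge5 X_basis DX1 DX2 DX3 DX4.
Let actE x c : act x c = iter x T c := coinv_act_iter charF le4p x c.
Let spanC := coinv_deg_span charF p_ge5 X_basis DX1 DX2 DX3 DX4.
Let coefC := coinv_reduced_free charF p_ge5 X_basis DX1 DX2 DX3 DX4.

Lemma coinv_mon34 a b : x3 ^+ a * x4 ^+ b = pi (lsub B 'X_[mnm4 0 0 a b]).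
Proof. by rewrite pi_lsub_mnm4 !expr0 !mul1r. Qed.

Lemma coinv_mon234 a b : x2 * x3 ^+ a * x4 ^+ b = pi (lsub B 'X_[mnm4 0 1 a b]).
Proof. by rewrite pi_lsub_mnm4 expr0 expr1 !mul1r. Qed.

(** The coefficients at m1 and then m2 form a triangular system, and coefficients at reduced
    monomials are determined by the class in the coinvariants. *)
Lemma coinv_free2 (q1 q2 : {mpoly F[4]}) m1 m2 : reduced p m1 -> reduced p m2 ->
  q1@_m1 != 0 -> q2@_m1 = 0 -> q2@_m2 != 0 ->
  forall a b : F, a *: pi (lsub B q1) + b *: pi (lsub B q2) = 0 -> a = 0 /\ b = 0.
Proof.
move=> r1 r2 q11 q21 q22 a b E.
have {E} E : pi (lsub B (a *: q1 + b *: q2)) = 0.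
  by rewrite /lsub raddfD /= !comp_mpolyZ raddfD /= [pi (a *: _)]linearZ [pi (b *: _)]linearZ.
have := coefC E r1; rewrite mcoeffD !mcoeffZ q21 mulr0 addr0 => /eqP.
rewrite mulf_eq0 (negbTE q11) orbF => /eqP a0.
have := coefC E r2; rewrite a0 scale0r add0r mcoeffZ => /eqP.
by rewrite mulf_eq0 (negbTE q22) orbF => /eqP ->.
Qed.

(** The numbers a and a' are the least exponents of x3 in degree d compatible with x4^p = 0, without
    and with a factor x2. Then n and m count the reduced monomials of the two kinds, so two chains
    of these lengths fill the component. *)
Lemma coinv_deg_high d a b a' b' n m :
  (p - 2 <= d <= 2 * p - 4)%N -> (a + b)%N = d -> (a' + b').+1 = d ->
  (b < p)%N -> (b' < p)%N -> (a <= d - (p - 1))%N -> (a' <= d - p)%N ->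
  (a + n = p - 1)%N -> (a' + m = p - 3)%N ->
  let u := x3 ^+ a * x4 ^+ b in let w := x2 * x3 ^+ a' * x4 ^+ b' in
  [/\ direct_sum (C d) (gen u) (gen w), submodule_iso act (gen u) (V n),
      submodule_iso act (gen w) (V m), submodule_iso act (C d) (sum_act (V n) (V m))
    & forall c, (C d c /\ fixed_points act c) <->
        span2 (x3 ^+ (p - 2) * x4 ^+ (d - (p - 2))) (x2 * x3 ^+ (p - 4) * x4 ^+ (d - (p - 3))) c].
Proof.
move=> /andP[d1 d2] ab ab' bp bp' la la' an am u w.
have n0 : (0 < n)%N by lia.
have m0 : (0 < m)%N by lia.
have an1 : (a + n.-1 = (p - 4).+2)%N by lia.
have am1 : (a' + m.-1 = p - 4)%N by lia.
have nb : (n.-1 <= b)%N by lia.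
have [k Eu] := iterD_top F2 xx2 Ux2 Ux3 Ux4 rel2 rel3 an1 nb.
have Ew := iterD_x2_top F2 xx2 Ux2 Ux3 Ux4 rel2 b' am1.
have Eu0 := iterD_top_eq0 F2 xx2 Ux2 Ux3 Ux4 rel2 rel3 b an1.
have Ew0 := iterD_x2_top_eq0 F2 xx2 Ux2 Ux3 Ux4 rel2 b' am1.
rewrite (prednK n0) in Eu0; rewrite (prednK m0) in Ew0.
pose e (j : 'I_(n + m)) := if (j < n)%N then x3 ^+ (a + j) * x4 ^+ (d - (a + j))
  else x2 * x3 ^+ (a' + (j - n)) * x4 ^+ (d.-1 - (a' + (j - n))).
have bn0 : ('C(b, n.-1) * n.-1`!)%:R != 0 :> F.
  rewrite natrM mulf_neq0 //; first by apply: (bin_neq0 charF); lia.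
  by apply: (fact_neq0 charF); lia.
have bm0 : ('C(b', m.-1) * m.-1`!)%:R != 0 :> F.
  rewrite natrM mulf_neq0 //; first by apply: (bin_neq0 charF); lia.
  by apply: (fact_neq0 charF); lia.
(* The matrix of the chain ends is triangular, with invertible diagonal entries [bn0] and [bm0]. *)
apply: (@two_chain_module F p _ T act p_gt1 actE (C d) _ _ _ n m u w
  (x3 ^+ (p - 2) * x4 ^+ (d - (p - 2))) (x2 * x3 ^+ (p - 4) * x4 ^+ (d - (p - 3)))
  ('C(b, n.-1) * n.-1`!)%:R k 0 ('C(b', m.-1) * m.-1`!)%:R
  _ _ _ _ _ _ _ _ _ _ e) => //.
- exact: coinv_deg0.
- exact: coinv_deg_closed.
- exact: coinv_degT.
- by lia.
- by lia.
- exact: coinv_deg_mon34.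
- exact: coinv_deg_mon234.
- rewrite coinv_mon34 coinv_mon234.
  apply: (@coinv_free2 _ _ (mnm4 0 0 (p - 2) (d - (p - 2))) (mnm4 0 1 (p - 4) (d - (p - 3))));
    rewrite ?reduced_mnm4 ?mcoeffX ?mnm4_eq ?eqxx ?oner_neq0 //=; lia.
- rewrite Eu; congr (_ *: (_ ^+ _ * _ ^+ _) + _ *: (_ * _ ^+ _)); lia.
- rewrite Ew scale0r add0r scaler_nat; congr (_ * _ ^+ _ *+ _); lia.
- by rewrite mulr0 subr0 mulf_neq0.
apply: spanC => i j ij li lj.
  have lt : (i - a < n + m)%N by lia.
  exists (Ordinal lt); rewrite /e /= (_ : (i - a < n)%N); last lia.
  by congr (_ ^+ _ * _ ^+ _); lia.
have lt : (n + (i - a') < n + m)%N by lia.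
exists (Ordinal lt); rewrite /e /= (_ : (n + (i - a') < n)%N = false); last lia.
by congr (_ * _ ^+ _ * _ ^+ _); lia.
Qed.

(** The chain of x4^d ends in x2 x3^(d-1) after d + 1 steps, one more than the power of x4 suggests;
    the scalar in w shortens the second chain to length d - 1, with an end that involves x3^d. *)
Lemma coinv_deg_low d (u := x4 ^+ d)
    (w := x3 ^+ 2 * x4 ^+ (d - 2) - ((d + 2)%:R / 2%:R) *: (x2 * x4 ^+ (d - 1))) :
  (2 <= d <= p - 3)%N ->
  [/\ direct_sum (C d) (gen u) (gen w), submodule_iso act (gen u) (V (d + 2)%N),
      submodule_iso act (gen w) (V (d - 1)%N),
      submodule_iso act (C d) (sum_act (V (d + 2)%N) (V (d - 1)%N))
    & forall c, (C d c /\ fixed_points act c) <->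
        span2 (x3 ^+ d - d%:R *: (x2 * x3 ^+ (d - 2) * x4)) (x2 * x3 ^+ (d - 1)) c].
Proof.
rewrite {}/u {}/w => /andP[d2 dp]; case: d d2 dp => [|[|k]] // _ dp.
have [-> -> ->] : [/\ k.+2 - 2 = k, k.+2 - 1 = k.+1 & k.+2 + 2 = k.+4]%N by split; lia.
set u := x4 ^+ _; pose w := x3 ^+ 2 * x4 ^+ k - (2%:R^-1 * (k + 4)%:R) *: (x2 * x4 ^+ k.+1).
rewrite (_ : (_ / _) = 2%:R^-1 * (k + 4)%:R); last by rewrite mulrC addn4.
rewrite -/w; have k1 : (0 < k.+2)%N by [].
have Eu := iterD_x4 F2 xx2 Ux2 Ux3 Ux4 k1.
have Eu0 := iterD_x4_eq0 F2 xx2 Ux2 Ux3 Ux4 k1.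
have [Ew Ew0] := iterD_second F2 xx2 Ux2 Ux3 Ux4 k.
have h0 : (2%:R^-1 : F) != 0 by rewrite invr_eq0.
have f0 : k`!%:R != 0 :> F by apply: (fact_neq0 charF); lia.
have c0 : 2%:R^-1 * (k.+2 * k.+3`!)%:R != 0 :> F.
  rewrite mulf_neq0 // natrM mulf_neq0 //; first by apply: (natr_neq0 charF); lia.
  by apply: (fact_neq0 charF); lia.
(* With d = k + 2 there are k + 3 monomials without x2 and k + 2 with it, while the chains have
   lengths k + 4 and k + 1; only the totals have to agree. *)
pose e (j : 'I_(k.+4 + k.+1)) := if (j < k.+3)%N then x3 ^+ j * x4 ^+ (k.+2 - j)
  else x2 * x3 ^+ (j - k.+3) * x4 ^+ (k.+1 - (j - k.+3)).
have s1E : x3 ^+ k.+2 - k.+2%:R *: (x2 * x3 ^+ k * x4) =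
    pi (lsub B ('X_[mnm4 0 0 k.+2 0] - k.+2%:R *: 'X_[mnm4 0 1 k 1])).
  have -> : x3 ^+ k.+2 = pi (lsub B 'X_[mnm4 0 0 k.+2 0]) by rewrite -coinv_mon34 expr0 mulr1.
  have -> : x2 * x3 ^+ k * x4 = pi (lsub B 'X_[mnm4 0 1 k 1]) by rewrite -coinv_mon234 expr1.
  by rewrite -linearZ -raddfB; apply: (congr1 pi); rewrite /lsub raddfB /= comp_mpolyZ.
have s2E : x2 * x3 ^+ k.+1 = pi (lsub B 'X_[mnm4 0 1 k.+1 0]).
  by rewrite -coinv_mon234 expr0 mulr1.
apply: (@two_chain_module F p _ T act p_gt1 actE (C k.+2) _ _ _ k.+4 k.+1 u w
  (x3 ^+ k.+2 - k.+2%:R *: (x2 * x3 ^+ k * x4)) (x2 * x3 ^+ k.+1)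
  0 (2%:R^-1 * (k.+2 * k.+3`!)%:R) k`!%:R (- (2%:R^-1 * k%:R) * k`!%:R)
  _ _ _ _ _ _ _ _ _ _ e) => //.
- exact: coinv_deg0.
- exact: coinv_deg_closed.
- exact: coinv_degT.
- by lia.
- by lia.
- by rewrite /u -[x4 ^+ _]mul1r -(expr0 x3); apply: coinv_deg_mon34.
- rewrite /w addrC -scaleNr; apply: coinv_deg_closed; last by apply: coinv_deg_mon34.
  by rewrite -[x2]mulr1 -(expr0 x3); apply: coinv_deg_mon234.
- rewrite s1E s2E.
  apply: (@coinv_free2 _ _ (mnm4 0 0 k.+2 0) (mnm4 0 1 k.+1 0));
    rewrite ?reduced_mnm4 ?mcoeffB ?mcoeffZ ?mcoeffX ?mnm4_eq ?eqxx ?oner_neq0 //=; try lia.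
  by rewrite mulr0 subr0 oner_neq0.
- by rewrite scale0r add0r Eu.
- by rewrite Ew mulrnBl -scaler_nat -[X in _ - X]scaler_nat scalerA mulNr scaleNr [k`!%:R * _]mulrC.
- by rewrite mul0r sub0r oppr_eq0 mulf_neq0.
apply: spanC => i j ij li lj.
  have lt : (i < k.+4 + k.+1)%N by lia.
  exists (Ordinal lt); rewrite /e /= (_ : (i < k.+3)%N); last lia.
  by congr (_ * _ ^+ _); lia.
have lt : (k.+3 + i < k.+4 + k.+1)%N by lia.
exists (Ordinal lt); rewrite /e /= (_ : (k.+3 + i < k.+3)%N = false); last lia.
by congr (_ * _ ^+ _ * _ ^+ _); lia.
Qed.

Lemma coinv_neq0 (q : {mpoly F[4]}) m : reduced p m -> q@_m != 0 -> pi (lsub B q) != 0.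
Proof. by move=> rm; apply: contraNneq => /coefC/(_ rm) ->. Qed.

Lemma coinv_deg_0 : submodule_iso act (C 0%N) (V 1%N).
Proof.
apply: (@one_chain_module F p _ T act p_gt1 actE _ _ _ _ 1 1 (fun=> 1)).
- exact: coinv_deg0.
- exact: coinv_deg_closed.
- exact: coinv_degT.
- by lia.
- by rewrite -[1](mulr1 1) -{1}(expr0 x3) -(expr0 x4); apply: coinv_deg_mon34.
- by rewrite /= rmorph1 subrr.
- exact: oner_neq0.
apply: spanC => // a b ab _ _; exists ord0; have [-> ->] : a = 0%N /\ b = 0%N by lia.
by rewrite !expr0 mulr1.
Qed.

(** The component is spanned by x3^(p-2) x4^(p-1): a reduced monomial containing x2 has degree at
    most 1 + (p-4) + (p-1) = 2p - 4. *)
Lemma coinv_deg_top : submodule_iso act (C (2 * p - 3)%N) (V 1%N).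
Proof.
have an : (p - 2 + 0 = (p - 4).+2)%N by lia.
apply: (@one_chain_module F p _ T act p_gt1 actE _ _ _ _ 1 (x3 ^+ (p - 2) * x4 ^+ (p - 1))
  (fun=> x3 ^+ (p - 2) * x4 ^+ (p - 1))).
- exact: coinv_deg0.
- exact: coinv_deg_closed.
- exact: coinv_degT.
- by lia.
- by apply: coinv_deg_mon34; lia.
- exact: (iterD_top_eq0 F2 xx2 Ux2 Ux3 Ux4 rel2 rel3 (p - 1) an).
- rewrite /= coinv_mon34; apply: (@coinv_neq0 _ (mnm4 0 0 (p - 2) (p - 1))).
    by rewrite reduced_mnm4 /=; lia.
  by rewrite mcoeffX eqxx oner_neq0.
apply: spanC => a b ab la lb; last by lia.
exists ord0; congr (_ ^+ _ * _ ^+ _); lia.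
Qed.

(** The chain of x4 already has length 3 and exhausts x4, x3, x2; the second chain of the low
    degrees would have length 0. *)
Lemma coinv_deg_1 : submodule_iso act (C 1%N) (V 3%N).
Proof.
apply: (@one_chain_module F p _ T act p_gt1 actE _ _ _ _ 3 (x4 ^+ 1)
  (fun j => nth 0 [:: x4; x3; x2] j)).
- exact: coinv_deg0.
- exact: coinv_deg_closed.
- exact: coinv_degT.
- by lia.
- by rewrite -[x4 ^+ _]mul1r -(expr0 x3); apply: coinv_deg_mon34.
- exact: (@iterD_x4_eq0 F _ T x2 x3 x4 F2 xx2 Ux2 Ux3 Ux4 1).
- rewrite (@iterD_x4 F _ T x2 x3 x4 F2 xx2 Ux2 Ux3 Ux4 1) // mulVf // scale1r.
  rewrite (_ : x2 * x3 ^+ 1.-1 = x2 * x3 ^+ 0 * x4 ^+ 0); last by rewrite /= !expr0 !mulr1.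
  rewrite coinv_mon234; apply: (@coinv_neq0 _ (mnm4 0 1 0 0)).
    by rewrite reduced_mnm4 /=; lia.
  by rewrite mcoeffX eqxx oner_neq0.
apply: spanC => a b ab _ _.
  case: a ab => [|[|//]] ab.
    have -> : b = 1%N by lia.
    by exists (@Ordinal 3 0 isT); rewrite expr0 mul1r.
  have -> : b = 0%N by lia.
  by exists (@Ordinal 3 1 isT); rewrite expr0 mulr1.
have [-> ->] : a = 0%N /\ b = 0%N by lia.
by exists (@Ordinal 3 2 isT); rewrite !expr0 !mulr1.
Qed.

End HomogeneousComponents.

(** * Assembly of the four ranges of degrees *)

Theorem theorem6p5 (F : fieldType) (p : nat)
    (p_prime : prime p) (p_ge5 : (5 <= p)%N) (charF : p \in [pchar F])
    (X1 X2 X3 X4 : 'rV[F]_4)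
    (X_basis : basis_of fullv [:: X1; X2; X3; X4])
    (DX1 : Delta p X1 = 0) (DX2 : Delta p X2 = X1)
    (DX3 : Delta p X3 = X2) (DX4 : Delta p X4 = X3) :
  let rho := V_rho F p 4 in
  let act := coinv_act rho in
  let C := coinv_deg rho in
  let gen := cyclic_submodule act in
  let x2 := coinv_pi rho (linear_form X2) in
  let x3 := coinv_pi rho (linear_form X3) in
  let x4 := coinv_pi rho (linear_form X4) in
  let V := V_act F p in
  [/\ (* (i) *)
      [/\ submodule_iso act (C 0%N) (V 1%N),
          submodule_iso act (C (2 * p - 3)%N) (V 1%N)
        & submodule_iso act (C 1%N) (V 3%N)],
      (* (ii) *)
      forall d : nat, (p <= d <= 2 * p - 4)%N ->
        let u := x3 ^+ (d - (p - 1)) * x4 ^+ (p - 1) in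
        let w := x2 * x3 ^+ (d - p) * x4 ^+ (p - 1) in
        [/\ direct_sum (C d) (gen u) (gen w),
            submodule_iso act (gen u) (V (2 * p - 2 - d)%N),
            submodule_iso act (gen w) (V (2 * p - 3 - d)%N),
            submodule_iso act (C d)
              (sum_act (V (2 * p - 2 - d)%N) (V (2 * p - 3 - d)%N))
          & forall c, (C d c /\ fixed_points act c) <->
              span2 (x3 ^+ (p - 2) * x4 ^+ (d - (p - 2)))
                    (x2 * x3 ^+ (p - 4) * x4 ^+ (d - (p - 3))) c],
      (* (iii) *)
      forall d : nat, d = (p - 1)%N \/ d = (p - 2)%N ->
        let u := x4 ^+ d in
        let w := x2 * x4 ^+ (d - 1) in
        [/\ direct_sum (C d) (gen u) (gen w),
            submodule_iso act (gen u) (V (p - 1)%N),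
            submodule_iso act (gen w) (V (p - 3)%N),
            submodule_iso act (C d) (sum_act (V (p - 1)%N) (V (p - 3)%N))
          & forall c, (C d c /\ fixed_points act c) <->
              span2 (x3 ^+ (p - 2) * x4 ^+ (d - (p - 2)))
                    (x2 * x3 ^+ (p - 4) * x4 ^+ (d - (p - 3))) c]
    & (* (iv) *)
      forall d : nat, (2 <= d <= p - 3)%N ->
        let u := x4 ^+ d in
        let w := x3 ^+ 2 * x4 ^+ (d - 2) -
                 ((d + 2)%:R / 2%:R) *: (x2 * x4 ^+ (d - 1)) in
        [/\ direct_sum (C d) (gen u) (gen w),
            submodule_iso act (gen u) (V (d + 2)%N),
            submodule_iso act (gen w) (V (d - 1)%N),
            submodule_iso act (C d) (sum_act (V (d + 2)%N) (V (d - 1)%N))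
          & forall c, (C d c /\ fixed_points act c) <->
              span2 (x3 ^+ d - d%:R *: (x2 * x3 ^+ (d - 2) * x4))
                    (x2 * x3 ^+ (d - 1)) c]].
Proof.
move=> rho act C gen x2 x3 x4 V; split.
- split; [exact: coinv_deg_0 X_basis _ _ _ _ | exact: coinv_deg_top X_basis _ _ _ _
    | exact: coinv_deg_1 X_basis _ _ _ _].
- move=> d dp u w; apply: (coinv_deg_high charF p_ge5 X_basis DX1 DX2 DX3 DX4); lia.
- move=> d dp u w.
  (* For d = p - 1 and d = p - 2 both least exponents of x3 are 0, which gives the lengths p - 1 and
     p - 3. *)
  have := @coinv_deg_high F p charF p_ge5 X1 X2 X3 X4 X_basis DX1 DX2 DX3 DX4
    d 0 d 0 (d - 1) (p - 1) (p - 3).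
  rewrite /= expr0 mul1r mulr1; apply; lia.
- by move=> d dp u w; apply: (coinv_deg_low charF p_ge5 X_basis DX1 DX2 DX3 DX4).
Qed.
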